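(* Let $(\mathcal Z,\widetilde{\mathcal Z})$, $\mathcal Z,\widetilde{\mathcal Z}:\Sigma\to\mathbb R^3$, be a minimal normalized Ribaucour pair with respective Gauss maps $\mathcal N$ and $\widetilde{\mathcal N}$, and let $(\rho,\phi)$ be Ribaucour data of $(\mathcal Z,\widetilde{\mathcal Z})$. Then $$\mathcal X^+:=\nabla^m_+\phi+\rho\,\mathcal N,\qquad\mathcal X^-:=-\frac{\nabla^m_-\rho}{\rho^2}+\frac1\phi\,\widetilde{\mathcal N}$$ are the associated fronts of a flat front $\mathbf X:\Sigma\to\mathbb H^3$ with hyperbolic Gauss maps $\mathcal G_+=\Pi\circ\mathcal N$ and $\mathcal G_-=\Pi\circ\widetilde{\mathcal N}$, respectively, where $\nabla^m_+$ and $\nabla^m_-$ denote the gradients with respect to the first fundamental forms of $\mathcal Z$ and $\widetilde{\mathcal Z}$. Moreover, if $$\omega_-:=\frac{4\,d\mathcal G_+}{(\mathcal G_+-\mathcal G_-)^2},\qquad\omega_+:=\frac{4\,d\mathcal G_-}{(\mathcal G_--\mathcal G_+)^2},$$ then $(\omega_+,\mathcal G_+)$ and $(\omega_-,\mathcal G_-)$ are Weierstrass data of $\mathcal Z$ and $\widetilde{\mathcal Z}$, respectively.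
   Context: $\Sigma$ is an oriented connected 2-manifold. Frontals $\mathcal Z,\widetilde{\mathcal Z}:\Sigma\to\mathbb R^3$ (smooth maps with smooth unit normals $\mathcal N,\widetilde{\mathcal N}:\Sigma\to\mathbb S^2$) are envelopes of a congruence of spheres if there is a smooth $\tau$ with $\mathcal Z+\tau\mathcal N=\widetilde{\mathcal Z}+\tau\widetilde{\mathcal N}$. The pair is Ribaucour integrable if $\mathcal N\ne\widetilde{\mathcal N}$ everywhere, $\mathcal Z,\widetilde{\mathcal Z}$ are envelopes of a congruence of spheres, and $\Re\int_\gamma\frac{d\widetilde{\mathcal G}}{\widetilde{\mathcal G}-\mathcal G}=0$ for every loop $\gamma$, with $\mathcal G=\Pi\circ\mathcal N$, $\widetilde{\mathcal G}=\Pi\circ\widetilde{\mathcal N}$, $\Pi(x_1,x_2,x_3)=(x_1+ix_2)/(1-x_3)$ (equivalently the smooth 1-form $\frac{\langle d\widetilde{\mathcal N},\mathcal N\rangle}{1-\langle\mathcal N,\widetilde{\mathcal N}\rangle}$ is exact). Ribaucour data are smooth functions $(\rho,\phi)$, $\rho$ nowhere zero, for which there is a frontal $\mathcal X_{\mathcal Z}$ with unit normal $\mathcal N$ satisfying $\rho=\langle\mathcal X_{\mathcal Z},\mathcal N\rangle$, $d\rho=\langle\mathcal X_{\mathcal Z},d\mathcal N\rangle$, $d\phi=\langle\mathcal X_{\mathcal Z},d\mathcal Z\rangle$, $\widetilde{\mathcal Z}=\mathcal Z-\frac{2\phi}{\|\mathcal X_{\mathcal Z}\|^2}\mathcal X_{\mathcal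 Z}$, $\widetilde{\mathcal N}=\mathcal N-\frac{2\rho}{\|\mathcal X_{\mathcal Z}\|^2}\mathcal X_{\mathcal Z}$. A minimal normalized Ribaucour pair is a Ribaucour integrable pair of minimal (non totally umbilical) immersions whose Ribaucour data satisfy, with $c=\tfrac12$, $d\rho=\langle\nabla^m\phi,d\mathcal N\rangle$, $\mathrm{Hess}(\phi)=c\rho\,I^m+(\rho-c\phi)\,II^m$, $|\nabla^m\phi|^2=-\rho^2+2c\rho\phi$, where $\nabla^m,\mathrm{Hess}$ are taken with respect to the first fundamental form $I^m$ of $\mathcal Z$ and $II^m=-\langle d\mathcal Z,d\mathcal N\rangle$. Weierstrass data: the conformal structure of $\Sigma$ is the one induced by $\mathcal Z$ for which $\Pi\circ\mathcal N$ is meromorphic; $(\omega,g)$ are Weierstrass data of $\mathcal Z$ if $g=\Pi\circ\mathcal N$ and $\mathcal Z=\Re\int\big(\tfrac12(1-g^2)\omega,\tfrac i2(1+g^2)\omega,g\omega\big)$ up to translation. Hyperbolic space: $\mathbb L^4=\mathbb R\times\mathbb R^3$ with $\ll(a,\mathbf p),(b,\mathbf q)\gg=-ab+\langle\mathbf p,\mathbf q\rangle$; $\mathbb H^3=\{\mathbf r\in\mathbb L^4:\ll\mathbf r,\mathbf r\gg=-1\}$ (no sign condition on the first coordinate is imposed; the image of a connected $\Sigma$ lies in one of the two sheets). A frontal $\mathbf X=(r,\mathbf x):\Sigma\to\mathbb H^3$ is a smooth map with smooth unit normal $\mathbf N=(s,\mathbf n)$ ($\ll\mathbf N,\mathbf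 N\gg=1$, $\ll\mathbf N,\mathbf X\gg=0$, $\ll d\mathbf X,\mathbf N\gg=0$); it is a front if $(\mathbf X,\mathbf N)$ is an immersion (likewise for frontals in $\mathbb R^3$ with their unit normals), and a front is flat if its first fundamental form has zero Gauss curvature at non-singular points (for fronts with many singular points: near each point, those parallel fronts $\cosh t\,\mathbf X+\sinh t\,\mathbf N$ that are immersions are flat). Writing $\mathbf X\pm\mathbf N=(r\pm s)(1,\mathcal N^\pm)$, the hyperbolic Gauss maps are $\mathcal G_\pm=\Pi\circ\mathcal N^\pm$ and the associated frontals (fronts) are $\mathcal X^\pm=\mathbf x-\frac r{r\pm s}(\mathbf x\pm\mathbf n)$, with unit normals $\mathcal N^\pm$. *)

(* Defs.v *)
From HB Require Import structures.
From mathcomp Require Import all_boot all_order all_algebra.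
From mathcomp.real_closed Require Import complex.
From mathcomp Require Import all_classical all_reals all_analysis.

Set Implicit Arguments.
Unset Strict Implicit.
Unset Printing Implicit Defensive.

Import Order.TTheory GRing.Theory Num.Theory.
Import numFieldNormedType.Exports.

Local Open Scope classical_set_scope.
Local Open Scope ring_scope.
Local Open Scope complex_scope.

(** * Smooth functions on open subsets of the plane *)

Definition partial (R : realType) (i : 'I_2) (f : 'rV[R]_2 -> R) :
    'rV[R]_2 -> R :=
  fun x => 'D_(delta_mx 0 i) f x.

(* Differentiability of every iterated partial derivative makes all of them
   continuous, so this is C^oo. *)
Definition smooth_on (R : realType) (U : set 'rV[R]_2) (f : 'rV[R]_2 -> R) :=
  forall (s : seq 'I_2) x, U x -> differentiable (foldr (@partial R) f s) x.

(** * Oriented connected surfaces *)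

(* [cmap] is only meaningful on [cdom], and [cinv] on [cmap @` cdom]. *)
Record chart (R : realType) (S : topologicalType) := Chart {
  cdom : set S;
  cmap :> S -> 'rV[R]_2;
  cinv : 'rV[R]_2 -> S }.

Section Charts.
Variables (R : realType) (S : topologicalType).
Implicit Types c : chart R S.

Definition is_chart c :=
  [/\ open (cdom c), open (c @` cdom c),
      forall p, cdom c p -> cinv c (c p) = p,
      {within cdom c, continuous c} &
      {within c @` cdom c, continuous (cinv c)}].

Definition overlap c1 c2 : set 'rV[R]_2 := c1 @` (cdom c1 `&` cdom c2).

Definition transition c1 c2 (j : 'I_2) : 'rV[R]_2 -> R :=
  fun x => c2 (cinv c1 x) 0 j.

Definition compatible c1 c2 := forall j,
  smooth_on (overlap c1 c2) (transition c1 c2 j) /\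
  smooth_on (overlap c2 c1) (transition c2 c1 j).

Definition orientation_compatible c1 c2 := forall x, overlap c1 c2 x ->
  0 < \det (\matrix_(i, j) partial i (transition c1 c2 j) x).

End Charts.

(* The smooth structure is given by its maximal atlas [atlas], which contains
   charts of both orientations; [oriented] is the class of positive charts. *)
Record surface (R : realType) := Surface {
  carrier :> topologicalType;
  atlas : set (chart R carrier);
  oriented : set (chart R carrier);
  surface_hausdorff : hausdorff_space carrier;
  surface_countable : @second_countable carrier;
  surface_connected : connected [set: carrier];
  atlas_chart : forall c, atlas c -> is_chart c;
  atlas_cover : forall p, exists c, atlas c /\ cdom c p;
  atlas_compatible : forall c1 c2, atlas c1 -> atlas c2 -> compatible c1 c2;
  atlas_maximal : forall c, is_chart c ->
    (forall c', atlas c' -> compatible c c') -> atlas c;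
  oriented_atlas : oriented `<=` atlas;
  oriented_cover : forall p, exists c, oriented c /\ cdom c p;
  oriented_compatible : forall c1 c2, oriented c1 -> oriented c2 ->
    orientation_compatible c1 c2 }.

Section Calculus.
Variables (R : realType) (S : surface R).
Implicit Types (c : chart R S) (p : S).

Definition chart_at p : chart R S := projT1 (cid (atlas_cover p)).

Definition smooth (f : S -> R) :=
  forall c, atlas c -> smooth_on (c @` cdom c) (f \o cinv c).

Definition smoothv n (F : S -> 'rV[R]_n) := forall k, smooth (fun p => F p 0 k).

Definition pd c (i : 'I_2) (f : S -> R) : S -> R :=
  fun p => partial i (f \o cinv c) (c p).

(* A real 1-form at p is the row of its values on the two coordinate fields. *)
Definition dform c (f : S -> R) p : 'rV[R]_2 := \row_i pd c i f p.

(* Row i is the derivative of F along the i-th coordinate field. *)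
Definition jac n c (F : S -> 'rV[R]_n) p : 'M[R]_(2, n) :=
  \matrix_(i, k) pd c i (fun q => F q 0 k) p.

(** ** Intrinsic geometry of a metric [g], given by its matrix in the chart *)

Definition christoffel c (g : S -> 'M[R]_2) (k i j : 'I_2) p : R :=
  2^-1 * \sum_l invmx (g p) k l *
    (pd c i (fun q => g q j l) p + pd c j (fun q => g q i l) p
     - pd c l (fun q => g q i j) p).

Definition hess c (g : S -> 'M[R]_2) (f : S -> R) p : 'M[R]_2 :=
  \matrix_(i, j) (pd c i (pd c j f) p
                  - \sum_k christoffel c g k i j p * pd c k f p).

(* Component l of R(e_0, e_1) e_1, with
   R(X, Y) = nabla_X nabla_Y - nabla_Y nabla_X - nabla_[X, Y]. *)
Definition riemann_0_1_1 c (g : S -> 'M[R]_2) (l : 'I_2) p : R :=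
  pd c 0 (christoffel c g l 1 1) p - pd c 1 (christoffel c g l 0 1) p
  + \sum_m (christoffel c g m 1 1 p * christoffel c g l 0 m p
            - christoffel c g m 0 1 p * christoffel c g l 1 m p).

Definition gauss_curvature c (g : S -> 'M[R]_2) p : R :=
  (\sum_l riemann_0_1_1 c g l p * g p l 0) / \det (g p).

(** ** Frontals and fronts *)

(* The scalar product with Gram matrix B on row vectors. *)
Definition sprod n (B : 'M[R]_n) (u v : 'rV[R]_n) : R := (u *m B *m v^T) 0 0.

Definition dot (u v : 'rV[R]_3) : R := sprod 1%:M u v.

(* L^4 = R x R^3 *)
Definition minkowski : 'M[R]_(1 + 3) := block_mx (- 1%:M) 0 0 1%:M.

Definition immersed_at n (F : S -> 'rV[R]_n) p :=
  forall c, atlas c -> cdom c p -> row_free (jac c F p).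

Definition immersion n (F : S -> 'rV[R]_n) :=
  smoothv F /\ forall p, immersed_at F p.

Definition frontal n (B : 'M[R]_n) (F nu : S -> 'rV[R]_n) :=
  [/\ smoothv F, smoothv nu, forall p, sprod B (nu p) (nu p) = 1 &
      forall c p, atlas c -> cdom c p -> jac c F p *m B *m (nu p)^T = 0].

Definition front n (B : 'M[R]_n) (F nu : S -> 'rV[R]_n) :=
  frontal B F nu /\ immersion (fun p => row_mx (F p) (nu p)).

Definition frontal3 (F nu : S -> 'rV[R]_3) := frontal 1%:M F nu.
Definition front3 (F nu : S -> 'rV[R]_3) := front 1%:M F nu.

Definition first_form n (B : 'M[R]_n) c (F : S -> 'rV[R]_n) p : 'M[R]_2 :=
  jac c F p *m B *m (jac c F p)^T.

Definition formI c (Z : S -> 'rV[R]_3) : S -> 'M[R]_2 := first_form 1%:M c Z.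

Definition formII c (Z N : S -> 'rV[R]_3) p : 'M[R]_2 :=
  - (jac c Z p *m (jac c N p)^T).

(* The gradient for the first fundamental form of the immersion Z, as a vector
   of R^3 tangent to Z; it does not depend on the chart. *)
Definition grad (Z : S -> 'rV[R]_3) (f : S -> R) p : 'rV[R]_3 :=
  let c := chart_at p in dform c f p *m invmx (formI c Z p) *m jac c Z p.

Definition minimal (Z N : S -> 'rV[R]_3) :=
  forall c p, atlas c -> cdom c p ->
    2^-1 * \tr (invmx (formI c Z p) *m formII c Z N p) = 0.

Definition totally_umbilical (Z N : S -> 'rV[R]_3) :=
  forall c p, atlas c -> cdom c p ->
    exists l : R, formII c Z N p = l *: formI c Z p.

Definition minimal_immersion (Z N : S -> 'rV[R]_3) :=
  [/\ frontal3 Z N, immersion Z, minimal Z N & ~ totally_umbilical Z N].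

(** ** Ribaucour pairs *)

Definition sphere_envelopes (Z N Zt Nt : S -> 'rV[R]_3) :=
  [/\ frontal3 Z N, frontal3 Zt Nt &
      exists2 tau : S -> R, smooth tau &
        forall p, Z p + tau p *: N p = Zt p + tau p *: Nt p].

(* The real part of dGt / (Gt - G) and -1/2 times the form below differ by
   the exact form d log(1 + |Gt|^2) / 2, which is singular where Gt = oo;
   vanishing of all periods is exactness of the (everywhere smooth) form. *)
Definition ribaucour_integrable (Z N Zt Nt : S -> 'rV[R]_3) :=
  [/\ forall p, N p != Nt p, sphere_envelopes Z N Zt Nt &
      exists2 f : S -> R, smooth f &
        forall c p, atlas c -> cdom c p ->
          dform c f p =
            (1 - dot (N p) (Nt p))^-1 *: (N p *m (jac c Nt p)^T)].

Definition ribaucour_data (Z N Zt Nt : S -> 'rV[R]_3) (rho phi : S -> R) :=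
  [/\ smooth rho, smooth phi, forall p, rho p != 0 &
    exists X : S -> 'rV[R]_3,
      [/\ frontal3 X N,
          forall p, rho p = dot (X p) (N p),
          forall c p, atlas c -> cdom c p ->
            dform c rho p = X p *m (jac c N p)^T /\
            dform c phi p = X p *m (jac c Z p)^T,
          forall p, Zt p = Z p - (2 * phi p / dot (X p) (X p)) *: X p &
          forall p, Nt p = N p - (2 * rho p / dot (X p) (X p)) *: X p]].

Definition normalized_equations (k : R) (Z N : S -> 'rV[R]_3)
    (rho phi : S -> R) :=
  forall c p, atlas c -> cdom c p ->
    [/\ dform c rho p = grad Z phi p *m (jac c N p)^T,
        hess c (formI c Z) phi p =
          (k * rho p) *: formI c Z p + (rho p - k * phi p) *: formII c Z N p &
        dot (grad Z phi p) (grad Z phi p) =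
          - rho p ^+ 2 + 2 * k * rho p * phi p].

Definition minimal_normalized_ribaucour_pair (Z N Zt Nt : S -> 'rV[R]_3) :=
  [/\ ribaucour_integrable Z N Zt Nt,
      minimal_immersion Z N, minimal_immersion Zt Nt &
      forall rho phi, ribaucour_data Z N Zt Nt rho phi ->
        normalized_equations 2^-1 Z N rho phi].

(** ** The Riemann sphere, Weierstrass data *)

(* Stereographic projection from (0, 0, 1) onto the Riemann sphere, where
   [None] is the point at infinity. *)
Definition stereo (x : 'rV[R]_3) : option R[i] :=
  if x 0 2 == 1 then None
  else Some ((x 0 0 / (1 - x 0 2)) +i* (x 0 1 / (1 - x 0 2))).

Definition sphere_inv (z : option R[i]) : option R[i] :=
  if z is Some a then (if a == 0 then None else Some a^-1) else Some 0.

Definition fin (z : option R[i]) : R[i] := odflt 0 z.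

Definition pdC c (i : 'I_2) (f : S -> R[i]) p : R[i] :=
  pd c i (fun q => complex.Re (f q)) p +i* pd c i (fun q => complex.Im (f q)) p.

(* Holomorphic near p as a function of the coordinate x_0 + i x_1 of c. *)
Definition holomorphic_at c (f : S -> R[i]) p :=
  \forall q \near p,
    [/\ differentiable ((fun q => complex.Re (f q)) \o cinv c) (c q),
        differentiable ((fun q => complex.Im (f q)) \o cinv c) (c q) &
        pdC c 1 f q = 'i%C * pdC c 0 f q].

(* Holomorphic as a map into the Riemann sphere. *)
Definition meromorphic_on c (G : S -> option R[i]) :=
  forall p, cdom c p ->
    (G p != None ->
       (\forall q \near p, G q != None) /\ holomorphic_at c (fin \o G) p) /\
    (G p != Some 0 ->
       (\forall q \near p, G q != Some 0) /\
       holomorphic_at c (fin \o sphere_inv \o G) p).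

(* The holomorphic charts of the conformal structure induced by Z for which
   stereo \o N is meromorphic. *)
Definition conformal_chart (Z N : S -> 'rV[R]_3) c :=
  [/\ atlas c, forall p, cdom c p -> is_scalar_mx (formI c Z p) &
      meromorphic_on c (stereo \o N)].

Definition weierstrass_vector (a w : R[i]) (k : 'I_3) : R[i] :=
  [:: 2^-1 * (1 - a ^+ 2) * w; 'i%C / 2 * (1 + a ^+ 2) * w; a * w]`_k.

(* Charts with coordinates conformal for Z always exist near each point
   (isothermal coordinates), so [conformal_chart] charts define the complex
   structure. A complex 1-form is given by its values [omega c i] on the coordinate
   fields. Z = Re (\int ...) up to translation is the equality of the
   differentials; it is required off the isolated poles of g. *)
Definition weierstrass_data (Z N : S -> 'rV[R]_3)
    (omega : chart R S -> 'I_2 -> S -> R[i]) (g : S -> option R[i]) :=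
  [/\ forall p, g p = stereo (N p),
      forall c p, conformal_chart Z N c -> cdom c p ->
        omega c 1 p = 'i%C * omega c 0 p /\ holomorphic_at c (omega c 0) p &
      forall c p (a : R[i]), atlas c -> cdom c p -> g p = Some a ->
        forall i k,
          jac c Z p i k = complex.Re (weierstrass_vector a (omega c i p) k)].

(* The form 4 dH / (H - G)^2 for maps G, H into the Riemann sphere with no
   common value. Where H = oo it is rewritten with the coordinate 1/H,
   as - 4 d(1/H) / (1 - G/H)^2; where G = oo it vanishes, as is seen on
   4 (1/G)^2 dH / (H/G - 1)^2. *)
Definition gauss_form (H G : S -> option R[i]) c (i : 'I_2) p : R[i] :=
  match H p, G p with
  | Some b, Some a => 4 * pdC c i (fin \o H) p / (b - a) ^+ 2
  | None, Some _ => - 4 * pdC c i (fin \o sphere_inv \o H) p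
  | _, None => 0
  end.

(** ** Fronts in hyperbolic space *)

Definition time_part (x : 'rV[R]_(1 + 3)) : R := lsubmx x 0 0.
Definition space_part (x : 'rV[R]_(1 + 3)) : 'rV[R]_3 := rsubmx x.

Definition hyperbolic_front (X Nu : S -> 'rV[R]_(1 + 3)) :=
  [/\ forall p, sprod minkowski (X p) (X p) = - 1,
      forall p, sprod minkowski (Nu p) (X p) = 0 &
      front minkowski X Nu].

Definition parallel (t : R) (X Nu : S -> 'rV[R]_(1 + 3)) p :=
  ((expR t + expR (- t)) / 2) *: X p + ((expR t - expR (- t)) / 2) *: Nu p.

(* t = 0 is the condition on X itself; the other parallel fronts matter at
   the singular points of X. *)
Definition flat_front (X Nu : S -> 'rV[R]_(1 + 3)) :=
  hyperbolic_front X Nu /\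
  forall t c p, atlas c -> cdom c p -> immersed_at (parallel t X Nu) p ->
    gauss_curvature c (first_form minkowski c (parallel t X Nu)) p = 0.

(* In the remaining definitions e = 1 or e = -1 is the sign in X + Nu, X - Nu;
   X + e Nu is a multiple of (1, lightlike_normal). *)
Definition lightlike_normal (e : R) (X Nu : S -> 'rV[R]_(1 + 3)) p :
    'rV[R]_3 :=
  (time_part (X p) + e * time_part (Nu p))^-1 *:
    (space_part (X p) + e *: space_part (Nu p)).

Definition associated_frontal (e : R) (X Nu : S -> 'rV[R]_(1 + 3)) p :
    'rV[R]_3 :=
  space_part (X p) -
    (time_part (X p) / (time_part (X p) + e * time_part (Nu p))) *:
      (space_part (X p) + e *: space_part (Nu p)).

Definition hyperbolic_gauss_map (e : R) (X Nu : S -> 'rV[R]_(1 + 3)) p :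
    option R[i] :=
  stereo (lightlike_normal e X Nu p).

End Calculus.

(* Main.v *)
Require Import Defs.
From HB Require Import structures.
From mathcomp Require Import all_boot all_order all_algebra.
From mathcomp.real_closed Require Import complex.
From mathcomp Require Import all_classical all_reals all_analysis.
From mathcomp Require Import ring lra.

Set Implicit Arguments.
Unset Strict Implicit.
Unset Printing Implicit Defensive.

Import Order.TTheory GRing.Theory Num.Theory.
Import numFieldNormedType.Exports.
Local Open Scope ring_scope.

(* Since Z is an immersion, X = grad phi + rho N, and the norm equation says
   |X|^2 = rho phi; the Hessian equation becomes 2 dX = rho dZ + phi dN. Hence
   Z~ = Z - (2/rho) X and N~ = N - (2/phi) X, and replacing
   (Z, N, X, rho, phi) by (Z~, N~, - X / |X|^2, 1/phi, 1/rho) preserves all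
   these equations, so that everything is symmetric in the two surfaces.

   The front is X = (A + B)/2 with normal Nu = (A - B)/2, where
   A = - (1, N) / rho and B = - phi (1, N~) are null vectors. From
   dB = - dphi (1, N) + rho (0, dZ) one reads off <dA, dA> = III / rho^2,
   <dB, dB> = rho^2 I and <dA, dB> = II. As Z is minimal, III is a multiple of
   I and II is trace-free, so the two fundamental forms of each parallel front
   have the same determinant, which is flatness by the Gauss equation.

   For the Weierstrass data, dN~ = - (rho/phi) (reflection along X)(dZ), so
   4 dG- / (G- - G+)^2 is an algebraic function of N and dZ: it is the
   coefficient omega for which dZ is the real part of the isotropic vector
   with data (omega, G+). The same formula for dZ~ shows that N is an immersion
   because Z~ is one, which fixes the orientation of conformal charts. *)

(** * Functions on the plane *)

(** The constant c = 1/2 is what turns the norm equation into |X|^2 = rho phi; since rho = <X, N>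
    has no zero, neither X nor phi has one. The factors of the null vectors are forced: the
    associated frontals are the time-zero points on the lines through the front in the directions
    (1, N) and (1, N~). Pairing with these directions gives rho = - 1 / (r + s) and 1 / phi = - 1 /
    (r - s). The fronts may be singular, so the induced metric cannot be assumed nondegenerate on a
    chart: the Gauss equation is proved at a point, with inverses used only near it. The Gauss maps
    may pass through infinity, so the formula for omega is proved separately there; once omega is
    expressed by N and dZ, holomorphy needs no distinction of cases. Finally, a conformal metric
    leaves the sign in d_1 Z = +- N x d_0 Z open. Testing against dN decides it, provided that the
    two vectors d_0 N, d_1 N are independent. *)

Lemma near_eq_differentiable (R : numFieldType) (V W : normedModType R)
    (f g : V -> W) (a : V) :
  (\forall x \near a, f x = g x) -> differentiable f a -> differentiable g a.
Proof.
move=> fg df; have fga := nbhs_singleton fg.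
(* The differential of [f] is the candidate for [g]: the two maps have the same first-order
   expansion at [a], and a differential is determined by that expansion. *)
have gE : g \o shift a = cst (g a) + 'd f a +o_ 0 id.
  apply/eqaddoP => e e0; have /eqaddoP/(_ e e0) := diff_locally df.
  have fg0 : \forall h \near 0, f (h + a) = g (h + a).
    by move: fg; rewrite (near_shift 0) subr0.
  apply: filterS2 fg0 => h /= fgh; rewrite !fctE /=.
  by rewrite fgh fga.
apply/diff_locallyP; rewrite (diff_unique (diff_continuous df) gE).
by split=> //; exact: diff_continuous.
Qed.

Section Plane.
Variable R : realType.
Local Open Scope classical_set_scope.
Implicit Types (U : set 'rV[R]_2) (f g : 'rV[R]_2 -> R) (i j : 'I_2).

Notation iterated f s := (foldr (@partial R) f s).

Lemma near_open U (P : set 'rV[R]_2) x :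
  open U -> U x -> (forall y, U y -> P y) -> \forall y \near x, P y.
Proof.
by move=> oU Ux UP; apply: filterS (open_nbhs_nbhs (conj oU Ux)).
Qed.

Lemma eq_partial U i f g x : open U -> U x ->
  (forall y, U y -> f y = g y) -> partial i f x = partial i g x.
Proof. by move=> oU Ux fg; apply/near_eq_derive/(near_open oU Ux). Qed.

Lemma eq_iterated U (s : seq 'I_2) f g : open U -> (forall y, U y -> f y = g y) ->
  forall y, U y -> iterated f s y = iterated g s y.
Proof. by move=> oU fg; elim: s => //= i s IH y Uy; apply: eq_partial IH. Qed.

Lemma eq_smooth_on U f g : open U -> (forall y, U y -> f y = g y) ->
  smooth_on U f -> smooth_on U g.
Proof.
move=> oU fg sf s x Ux; apply: near_eq_differentiable (sf s x Ux).
exact: (near_open oU Ux (eq_iterated s oU fg)).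
Qed.

(** [foldr] applies the last index of the list first, so a derivative taken beforehand is appended
    at the end. *)
Lemma smooth_on_partial U i f : smooth_on U f -> smooth_on U (partial i f).
Proof. by move=> sf s; have := sf (rcons s i); rewrite foldr_rcons. Qed.

(** Bounding the order makes induction possible: by the Leibniz rule, a product is differentiable up
    to order k + 1 once certain products are so up to order k. *)
Definition smooth_upto U (k : nat) f :=
  forall (s : seq 'I_2) x, (size s <= k)%N -> U x -> differentiable (iterated f s) x.

Lemma smooth_uptoS U k f : smooth_upto U k.+1 f <->
  (forall x, U x -> differentiable f x) /\
  forall i, smooth_upto U k (partial i f).
Proof.
split=> [sf|[df sf]]; first split.
- by move=> x; apply: (sf [::]).
- move=> i s x sk; have := sf (rcons s i) x.
  by rewrite foldr_rcons size_rcons ltnS; apply.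
- move=> s x; elim/last_ind: s => [_|s i _]; first exact: df.
  by rewrite foldr_rcons size_rcons ltnS; apply: sf.
Qed.

Lemma smooth_uptoW U k f : smooth_upto U k.+1 f -> smooth_upto U k f.
Proof. by move=> sf s x sk; apply: sf; apply: leqW. Qed.

Lemma smooth_onP U f : smooth_on U f <-> forall k, smooth_upto U k f.
Proof. by split=> sf => [k s x _|s x]; [apply: sf|apply: sf (leqnn _)]. Qed.

Lemma eq_smooth_upto U k f g : open U -> (forall y, U y -> f y = g y) ->
  smooth_upto U k f -> smooth_upto U k g.
Proof.
move=> oU fg sf s x sk Ux; apply: near_eq_differentiable (sf s x sk Ux).
exact: (near_open oU Ux (eq_iterated s oU fg)).
Qed.

Lemma partialD i f g x : differentiable f x -> differentiable g x ->
  partial i (fun y => f y + g y) x = partial i f x + partial i g x.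
Proof.
by move=> /diff_derivable df /diff_derivable dg; apply: deriveD (df _) (dg _).
Qed.

Lemma partialM i f g x : differentiable f x -> differentiable g x ->
  partial i (fun y => f y * g y) x = partial i f x * g x + f x * partial i g x.
Proof.
move=> /diff_derivable df /diff_derivable dg; rewrite /partial.
rewrite (deriveM (df _) (dg _)).
by rewrite /GRing.scale /= addrC [g x * _]mulrC.
Qed.

Lemma partialV i f x : differentiable f x -> f x != 0 ->
  partial i (fun y => (f y)^-1) x = - (partial i f x * (f x)^-1 * (f x)^-1).
Proof.
move=> /diff_derivable df f0; rewrite /partial deriveV//.
by rewrite /GRing.scale /= -exprVn; ring.
Qed.

Lemma partial_cst i (a : R) x : partial i (fun=> a) x = 0.
Proof. exact: derive_cst. Qed.

Lemma smooth_on_cst U (a : R) : smooth_on U (fun=> a).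
Proof.
move=> s x _; suff [b ->] : exists b, iterated (fun=> a) s = fun=> b.
  exact: differentiable_cst.
elim: s => [|i s [b /= ->]]; first by exists a.
by exists 0; apply/funext => y; rewrite partial_cst.
Qed.

Lemma smooth_uptoD U k f g : open U -> smooth_upto U k f ->
  smooth_upto U k g -> smooth_upto U k (fun y => f y + g y).
Proof.
move=> oU; elim: k f g => [|k IH] f g.
  move=> sf sg [|//] x _ Ux /=.
  by apply: differentiableD; [apply: (sf [::])|apply: (sg [::])].
move=> /smooth_uptoS[df sf] /smooth_uptoS[dg sg]; apply/smooth_uptoS; split.
  by move=> x Ux; apply: differentiableD; [apply: df|apply: dg].
move=> i; apply: eq_smooth_upto (IH _ _ (sf i) (sg i)) => // y Uy.
by rewrite partialD//; [apply: df|apply: dg].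
Qed.

Lemma smooth_uptoM U k f g : open U -> smooth_upto U k f ->
  smooth_upto U k g -> smooth_upto U k (fun y => f y * g y).
Proof.
move=> oU; elim: k f g => [|k IH] f g.
  move=> sf sg [|//] x _ Ux /=.
  by apply: differentiableM; [apply: (sf [::])|apply: (sg [::])].
move=> sf sg; have sf' := smooth_uptoW sf; have sg' := smooth_uptoW sg.
move: sf sg => /smooth_uptoS[df sf] /smooth_uptoS[dg sg].
apply/smooth_uptoS; split.
  by move=> x Ux; apply: differentiableM; [apply: df|apply: dg].
move=> i; apply: eq_smooth_upto
  (smooth_uptoD oU (IH _ _ (sf i) sg') (IH _ _ sf' (sg i))) => // y Uy.
by rewrite partialM//; [apply: df|apply: dg].
Qed.

Lemma smooth_onD U f g : open U -> smooth_on U f -> smooth_on U g ->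
  smooth_on U (fun y => f y + g y).
Proof.
move=> oU /smooth_onP sf /smooth_onP sg.
by apply/smooth_onP => k; apply: smooth_uptoD.
Qed.

Lemma smooth_onM U f g : open U -> smooth_on U f -> smooth_on U g ->
  smooth_on U (fun y => f y * g y).
Proof.
move=> oU /smooth_onP sf /smooth_onP sg.
by apply/smooth_onP => k; apply: smooth_uptoM.
Qed.

(** The derivative - f' / f^2 contains 1 / f again, but only to the order that the induction has
    already reached. *)
Lemma smooth_onV U f : open U -> smooth_on U f -> (forall x, U x -> f x != 0) ->
  smooth_on U (fun y => (f y)^-1).
Proof.
move=> oU sf f0.
have dV x : U x -> differentiable (fun y => (f y)^-1) x.
  by move=> Ux; apply: differentiableV (sf [::] x Ux) (f0 x Ux).
apply/smooth_onP; elim=> [|k IH]; first by move=> [|//] x _ Ux; apply: dV.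
apply/smooth_uptoS; split=> // i.
have sN1 := (smooth_onP _ _).1 (@smooth_on_cst U (-1)) k.
have si := (smooth_onP _ _).1 (smooth_on_partial i sf) k.
apply: eq_smooth_upto
  (smooth_uptoM oU sN1 (smooth_uptoM oU (smooth_uptoM oU si IH) IH)) => // y Uy.
by rewrite partialV ?mulN1r//; [apply: (sf [::])|apply: f0].
Qed.

Lemma is_derive_line f (a v : 'rV[R]_2) (t : R) : differentiable f (a + t *: v) ->
  is_derive t 1 (fun s => f (a + s *: v)) ('D_v f (a + t *: v)).
Proof.
move=> df; have /derivableP := @diff_derivable _ _ _ _ _ v df.
have E : (fun h => h^-1 *: (((fun s => f (a + s *: v)) \o shift t) (h *: 1)
    - f (a + t *: v))) =
  (fun h => h^-1 *: ((f \o shift (a + t *: v)) (h *: v) - f (a + t *: v))).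
  apply/funext => h /=; congr (_ *: (f _ - _)).
  by rewrite [RHS]addrCA -scalerDl [h *: 1]mulr1.
by move=> [dr _]; split; rewrite /derivable /derive E.
Qed.

(* Two applications of the mean value theorem to the second difference of f
   on the parallelogram x, x + h v, x + h w, x + h v + h w. *)
Lemma second_difference U f (v w x : 'rV[R]_2) (h : R) : 0 < h ->
  (forall y, U y -> differentiable f y) ->
  (forall y, U y -> differentiable ('D_v f) y) ->
  (forall s t, 0 <= s <= h -> 0 <= t <= h -> U (x + s *: v + t *: w)) ->
  exists s t, [/\ 0 <= s <= h, 0 <= t <= h &
    f (x + h *: v + h *: w) - f (x + h *: w) - (f (x + h *: v) - f x) =
    h ^+ 2 * 'D_w ('D_v f) (x + s *: v + t *: w)].
Proof.
move=> h0 df ddf UU.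
have hh : 0 <= h <= h by rewrite lexx ltW.
have zz : 0 <= (0 : R) <= h by rewrite lexx ltW.
pose F s := f (x + h *: w + s *: v) - f (x + s *: v).
pose dF s := 'D_v f (x + h *: w + s *: v) - 'D_v f (x + s *: v).
have dFs s : 0 <= s <= h -> is_derive s 1 F (dF s).
  move=> sh; apply: is_deriveB; apply: is_derive_line; apply: df.
    by rewrite addrAC; exact: UU.
  by have := UU s 0 sh zz; rewrite scale0r addr0.
have cF : {within `[0, h], continuous F}.
  apply: derivable_within_continuous => s.
  by rewrite in_itv /= => /dFs[].
have [s s0h Fh] : exists2 s, s \in `]0, h[%R & F h - F 0 = dF s * (h - 0).
  apply: (@MVT _ F dF 0 h h0 _ cF) => s; rewrite in_itv /= => /andP[s0 sh].
  by apply: dFs; rewrite !ltW.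
have {}s0h : 0 <= s <= h by move: s0h; rewrite in_itv /= => /andP[??]; rewrite !ltW.
pose G t := 'D_v f (x + s *: v + t *: w).
pose dG t := 'D_w ('D_v f) (x + s *: v + t *: w).
have dGt t : 0 <= t <= h -> is_derive t 1 G (dG t).
  by move=> th; apply: is_derive_line; apply: ddf; exact: UU.
have cG : {within `[0, h], continuous G}.
  apply: derivable_within_continuous => t.
  by rewrite in_itv /= => /dGt[].
have [t t0h Gh] : exists2 t, t \in `]0, h[%R & G h - G 0 = dG t * (h - 0).
  apply: (@MVT _ G dG 0 h h0 _ cG) => t; rewrite in_itv /= => /andP[t0 th].
  by apply: dGt; rewrite !ltW.
exists s, t; split=> //.
  by move: t0h; rewrite in_itv /= => /andP[??]; rewrite !ltW.
have -> : f (x + h *: v + h *: w) - f (x + h *: w) - (f (x + h *: v) - f x)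
  = F h - F 0.
  by rewrite /F !scale0r !addr0 [x + _ *: w + _]addrAC; ring.
rewrite Fh /dF [x + _ *: w + _]addrAC.
rewrite -[in X in _ - X](addr0 (x + s *: v)) -[in X in _ - X](scale0r w).
by rewrite -/(G h) -/(G 0) Gh subr0 /dG; ring.
Qed.

(** The second difference of [f] on a small parallelogram is symmetric in the two directions and
    equals h^2 times either mixed derivative at some point near [x]. As both derivatives are
    continuous at [x], they agree there. *)
Lemma partialC U f x i j : open U -> U x -> smooth_on U f ->
  partial i (partial j f) x = partial j (partial i f) x.
Proof.
move=> oU Ux sf.
have [u uE] : exists u : 'I_2 -> 'I_2 -> 'rV[R]_2 -> R,
    forall k l, u k l = partial k (partial l f).
  by exists (fun k l => partial k (partial l f)).
rewrite -!uE; apply/eqP/negP => /negP ne.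
have cu (k l : 'I_2) : {for x, continuous (u k l)}.
  rewrite uE; apply: differentiable_continuous; exact: (sf [:: k; l]).
(* Half the gap: near [x] each mixed derivative moves by less than [e], and two such errors cannot
   bridge the gap. *)
pose e := `|u i j x - u j i x| / 2.
have e0 : 0 < e by rewrite divr_gt0// normr_gt0 subr_eq0.
have near_u (k l : 'I_2) : \forall y \near x, `|u k l x - u k l y| < e.
  by move/cvgrPdist_lt : (cu k l); apply.
have nU : \forall y \near x, U y by exact: near_open oU Ux _.
have /nbhs_ballP[d /= d0 dP] : \forall y \near x,
    [/\ U y, `|u i j x - u i j y| < e & `|u j i x - u j i y| < e].
  by apply: filterS3 nU (near_u i j) (near_u j i) => y.
pose v (k : 'I_2) : 'rV[R]_2 := delta_mx 0 k.
(* This keeps the parallelogram within distance d / 2 of [x]; the summand 1 makes the denominator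
   positive. *)
pose h := d / 2 / (`|v i| + `|v j| + 1).
have den : 0 < `|v i| + `|v j| + 1 by rewrite ltr_wpDl// addr_ge0.
have h0 : 0 < h by rewrite !divr_gt0.
have box (k l : 'I_2) s t : `|v k| + `|v l| = `|v i| + `|v j| ->
    0 <= s <= h -> 0 <= t <= h -> ball x d (x + s *: v k + t *: v l).
  move=> kl /andP[s0 sh] /andP[t0 th]; rewrite -ball_normE /= -addrA opprD addrA.
  rewrite subrr sub0r normrN (le_lt_trans (ler_normD _ _))// !normrZ.
  rewrite !ger0_norm//.
  apply: (@le_lt_trans _ _ (h * (`|v i| + `|v j| + 1))).
    by rewrite mulrDr mulr1 -kl mulrDr ler_wpDr ?(ltW h0)// lerD// ler_wpM2r.
  by rewrite /h divfK ?gt_eqF// ltr_pdivrMr// mulr_natr mulr2n ltrDl.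
have [s [t [sh th E1]]] : exists s t, [/\ 0 <= s <= h, 0 <= t <= h &
    f (x + h *: v i + h *: v j) - f (x + h *: v j) - (f (x + h *: v i) - f x) =
    h ^+ 2 * u j i (x + s *: v i + t *: v j)].
  rewrite uE; apply: (second_difference (U := U)) => //.
  - exact: (sf [::]).
  - exact: (sf [:: i]).
  - by move=> s t sh th; have /dP[] := box i j s t erefl sh th.
have [s' [t' [sh' th' E2]]] : exists s t, [/\ 0 <= s <= h, 0 <= t <= h &
    f (x + h *: v j + h *: v i) - f (x + h *: v i) - (f (x + h *: v j) - f x) =
    h ^+ 2 * u i j (x + s *: v j + t *: v i)].
  rewrite uE; apply: (second_difference (U := U)) => //.
  - exact: (sf [::]).
  - exact: (sf [:: j]).
  - by move=> s' t' sh' th'; have /dP[] := box j i s' t' (addrC _ _) sh' th'.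
have [_ _ B1] := dP _ (box i j s t erefl sh th).
have [_ B2 _] := dP _ (box j i s' t' (addrC _ _) sh' th').
have E : u j i (x + s *: v i + t *: v j) = u i j (x + s' *: v j + t' *: v i).
  have h2 : h ^+ 2 != 0 by rewrite sqrf_eq0 gt_eqF.
  apply: (mulfI h2); rewrite -E1 -E2 [x + _ *: v j + _]addrAC.
  move: (f (x + _ + _)) (f (x + h *: v j)) (f (x + h *: v i)) (f x) => r1 r2 r3 r4.
  by ring.
rewrite E in B1; set w := u i j (_ + _ + _) in B1 B2.
have : `|u i j x - u j i x| < e + e.
  rewrite -[u i j x](subrK w) -[u j i x](subrK w) opprD addrACA subrr addr0.
  by apply: le_lt_trans (ler_normB _ _) _; rewrite ltrD.
by rewrite /e -splitr ltxx.
Qed.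

End Plane.

(** * Calculus in a chart *)

Section ScalarProduct.
Variables (R : realType) (n : nat) (B : 'M[R]_n).
Implicit Types u v w : 'rV[R]_n.

Lemma sprodE u v : sprod B u v = \sum_k \sum_l u 0 k * B k l * v 0 l.
Proof.
rewrite /sprod mxE exchange_big /=; apply: eq_bigr => l _.
by rewrite !mxE mulr_suml.
Qed.

Lemma sprodDl u v w : sprod B (u + v) w = sprod B u w + sprod B v w.
Proof. by rewrite /sprod !mulmxDl mxE. Qed.

Lemma sprodDr u v w : sprod B w (u + v) = sprod B w u + sprod B w v.
Proof. by rewrite /sprod linearD mulmxDr mxE. Qed.

Lemma sprodZl a u w : sprod B (a *: u) w = a * sprod B u w.
Proof. by rewrite /sprod -!scalemxAl mxE. Qed.

Lemma sprodZr a u w : sprod B w (a *: u) = a * sprod B w u.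
Proof. by rewrite /sprod linearZ -scalemxAr mxE. Qed.

Lemma sprodNl u w : sprod B (- u) w = - sprod B u w.
Proof. by rewrite -scaleN1r sprodZl mulN1r. Qed.

Lemma sprodNr u w : sprod B w (- u) = - sprod B w u.
Proof. by rewrite -scaleN1r sprodZr mulN1r. Qed.

Lemma sprodBl u v w : sprod B (u - v) w = sprod B u w - sprod B v w.
Proof. by rewrite sprodDl sprodNl. Qed.

Lemma sprodBr u v w : sprod B w (u - v) = sprod B w u - sprod B w v.
Proof. by rewrite sprodDr sprodNr. Qed.

Lemma sprodC u v : B^T = B -> sprod B u v = sprod B v u.
Proof.
move=> Bs; rewrite /sprod -[in LHS](trmxK (u *m B *m v^T)) mxE.
by rewrite !trmx_mul trmxK Bs mulmxA.
Qed.

End ScalarProduct.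

Section Chart.
Variables (R : realType) (S : surface R) (c : chart R S).
Local Open Scope classical_set_scope.
Implicit Types (f g : S -> R) (i j : 'I_2) (p q : S).

(** Smoothness in the single chart [c], because coordinate expressions such as [pd c i f] have a
    meaning only on the domain of [c]. *)
Definition chart_smooth f := smooth_on (c @` cdom c) (f \o cinv c).
Definition chart_diff f p := differentiable (f \o cinv c) (c p).

Lemma pdD i f g p : chart_diff f p -> chart_diff g p ->
  pd c i (fun q => f q + g q) p = pd c i f p + pd c i g p.
Proof. exact: partialD. Qed.

Lemma pdM i f g p : chart_diff f p -> chart_diff g p ->
  cinv c (c p) = p ->
  pd c i (fun q => f q * g q) p = pd c i f p * g p + f p * pd c i g p.
Proof. by move=> df dg cK; rewrite [LHS](partialM i df dg) /= cK. Qed.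

Lemma pdV i f p : chart_diff f p -> cinv c (c p) = p -> f p != 0 ->
  pd c i (fun q => (f q)^-1) p = - (pd c i f p * (f p)^-1 * (f p)^-1).
Proof. by move=> df cK f0; rewrite [LHS](partialV i df) /= cK. Qed.

Lemma pd_cst i (a : R) p : pd c i (fun=> a) p = 0.
Proof. exact: partial_cst. Qed.

Lemma chart_diffD f g p : chart_diff f p -> chart_diff g p ->
  chart_diff (fun q => f q + g q) p.
Proof. exact: differentiableD. Qed.

Lemma chart_diffM f g p : chart_diff f p -> chart_diff g p ->
  chart_diff (fun q => f q * g q) p.
Proof. exact: differentiableM. Qed.

Lemma chart_diffV f p : chart_diff f p -> cinv c (c p) = p -> f p != 0 ->
  chart_diff (fun q => (f q)^-1) p.
Proof. by move=> df cK f0; apply: (differentiableV df); rewrite /= cK. Qed.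

Lemma chart_diff_cst (a : R) p : chart_diff (fun=> a) p.
Proof. exact: differentiable_cst. Qed.

Hypothesis hc : atlas c.

Let c_chart : is_chart c := atlas_chart hc.

Lemma cmap_open : open (c @` cdom c).
Proof. by case: c_chart. Qed.

Lemma cdom_open : open (cdom c).
Proof. by case: c_chart. Qed.

Lemma cmapK p : cdom c p -> cinv c (c p) = p.
Proof. by case: c_chart => _ _ H _ _; apply: H. Qed.

Let oV := cmap_open.

Lemma eq_on_cmap f g : (forall p, cdom c p -> f p = g p) ->
  forall x, (c @` cdom c) x -> (f \o cinv c) x = (g \o cinv c) x.
Proof. by move=> fg _ [p cp <-] /=; rewrite cmapK// fg. Qed.

Lemma pd_ext i f g p : cdom c p -> (forall q, cdom c q -> f q = g q) ->
  pd c i f p = pd c i g p.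
Proof.
by move=> cp fg; apply: (eq_partial i oV _ (eq_on_cmap fg)); exists p.
Qed.

Lemma chart_smooth_diff f p : chart_smooth f -> cdom c p -> chart_diff f p.
Proof. by move=> sf cp; apply: (sf [::]); exists p. Qed.

Lemma eq_chart_smooth f g : (forall p, cdom c p -> f p = g p) ->
  chart_smooth f -> chart_smooth g.
Proof. by move=> fg; apply: eq_smooth_on oV (eq_on_cmap fg). Qed.

Lemma chart_smooth_cst (a : R) : chart_smooth (fun=> a).
Proof. exact: smooth_on_cst. Qed.

Lemma chart_smoothD f g : chart_smooth f -> chart_smooth g ->
  chart_smooth (fun p => f p + g p).
Proof. exact: smooth_onD. Qed.

Lemma chart_smoothM f g : chart_smooth f -> chart_smooth g ->
  chart_smooth (fun p => f p * g p).
Proof. exact: smooth_onM. Qed.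

Lemma chart_smoothN f : chart_smooth f -> chart_smooth (fun p => - f p).
Proof.
move=> sf; apply: eq_chart_smooth (chart_smoothM (chart_smooth_cst (-1)) sf).
by move=> p _; rewrite mulN1r.
Qed.

Lemma chart_smoothB f g : chart_smooth f -> chart_smooth g ->
  chart_smooth (fun p => f p - g p).
Proof. by move=> sf sg; apply: chart_smoothD (chart_smoothN sg). Qed.

Lemma chart_smoothV f : (forall p, cdom c p -> f p != 0) -> chart_smooth f ->
  chart_smooth (fun p => (f p)^-1).
Proof.
move=> f0 sf; apply: smooth_onV => // _ [p cp <-] /=.
by rewrite cmapK// f0.
Qed.

Lemma chart_smooth_sum m (F : 'I_m -> S -> R) :
  (forall k, chart_smooth (F k)) -> chart_smooth (fun p => \sum_k F k p).
Proof.
elim: m F => [|m IH] F sF.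
  by apply: eq_chart_smooth (chart_smooth_cst 0) => p _; rewrite big_ord0.
have sl := chart_smoothD (sF ord0) (IH _ (fun k => sF (lift ord0 k))).
by apply: eq_chart_smooth sl => p _; rewrite big_ord_recl.
Qed.

Lemma chart_smooth_pd i f : chart_smooth f -> chart_smooth (pd c i f).
Proof.
move=> sf; apply: eq_smooth_on oV _ (smooth_on_partial i sf).
by move=> _ [p cp <-]; rewrite /= /pd cmapK.
Qed.

Lemma pd_pdC i j f p : chart_smooth f -> cdom c p ->
  pd c i (pd c j f) p = pd c j (pd c i f) p.
Proof.
move=> sf cp; have cV : (c @` cdom c) (c p) by exists p.
have E k : forall x, (c @` cdom c) x ->
    (pd c k f \o cinv c) x = partial k (f \o cinv c) x.
  by move=> _ [q cq <-]; rewrite /= /pd cmapK.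
rewrite /pd -!/(pd c _ f) (eq_partial i oV cV (E j)).
by rewrite (eq_partial j oV cV (E i)) (partialC _ _ oV).
Qed.

Lemma pdN i f p : chart_diff f p -> cdom c p ->
  pd c i (fun q => - f q) p = - pd c i f p.
Proof.
move=> df cp; have d1 := chart_diff_cst (-1) p.
have -> : pd c i (fun q => - f q) p = pd c i (fun q => -1 * f q) p.
  by apply: pd_ext => // q _; rewrite mulN1r.
by rewrite (pdM i d1 df (cmapK cp)) pd_cst mul0r add0r mulN1r.
Qed.

Lemma pd_sum i m (F : 'I_m -> S -> R) p :
  (forall k, chart_smooth (F k)) -> cdom c p ->
  pd c i (fun q => \sum_k F k q) p = \sum_k pd c i (F k) p.
Proof.
move=> + cp; elim: m F => [|m IH] F sF.
  rewrite big_ord0 (@pd_ext i _ (fun=> 0)) ?pd_cst// => q _.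
  by rewrite big_ord0.
rewrite big_ord_recl -IH; last by move=> k; apply: sF.
rewrite -pdD; first by apply: pd_ext => // q _; rewrite big_ord_recl.
  exact: chart_smooth_diff.
by apply: chart_smooth_diff => //; apply: chart_smooth_sum => k; apply: sF.
Qed.

Section Vectors.
Variable n : nat.
Implicit Types (F G : S -> 'rV[R]_n).

Definition chart_smoothv F := forall k, chart_smooth (fun p => F p 0 k).
Definition vd i F p : 'rV[R]_n := row i (jac c F p).

Lemma vdE i F p k : vd i F p 0 k = pd c i (fun q => F q 0 k) p.
Proof. by rewrite !mxE. Qed.

Lemma chart_smoothv_vd i F : chart_smoothv F -> chart_smoothv (vd i F).
Proof.
move=> sF k; apply: eq_chart_smooth (chart_smooth_pd i (sF k)) => p _.
by rewrite vdE.
Qed.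

Lemma vd_vdC i j F p : chart_smoothv F -> cdom c p ->
  vd i (vd j F) p = vd j (vd i F) p.
Proof.
move=> sF cp; apply/rowP => k; rewrite !vdE.
rewrite (@pd_ext i _ (pd c j (fun q => F q 0 k))) => [|//|q _]; last by rewrite vdE.
rewrite (@pd_ext j _ (pd c i (fun q => F q 0 k))) => [|//|q _]; last by rewrite vdE.
exact: pd_pdC.
Qed.

Lemma chart_smoothvD F G : chart_smoothv F -> chart_smoothv G ->
  chart_smoothv (fun p => F p + G p).
Proof.
move=> sF sG k; apply: eq_chart_smooth (chart_smoothD (sF k) (sG k)) => p _.
by rewrite mxE.
Qed.

Lemma chart_smoothvZ f F : chart_smooth f -> chart_smoothv F ->
  chart_smoothv (fun p => f p *: F p).
Proof.
move=> sf sF k; apply: eq_chart_smooth (chart_smoothM sf (sF k)) => p _.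
by rewrite mxE.
Qed.

Lemma chart_smoothvN F : chart_smoothv F -> chart_smoothv (fun p => - F p).
Proof.
move=> sF k; apply: eq_chart_smooth (chart_smoothN (sF k)) => p _.
by rewrite mxE.
Qed.

Lemma vdD i F G p : chart_smoothv F -> chart_smoothv G -> cdom c p ->
  vd i (fun q => F q + G q) p = vd i F p + vd i G p.
Proof.
move=> sF sG cp; apply/rowP => k; rewrite vdE [RHS]mxE !vdE -pdD.
- by apply: pd_ext => // q _; rewrite mxE.
- exact: chart_smooth_diff.
- exact: chart_smooth_diff.
Qed.

Lemma vdZ i f F p : chart_smooth f -> chart_smoothv F -> cdom c p ->
  vd i (fun q => f q *: F q) p = pd c i f p *: F p + f p *: vd i F p.
Proof.
move=> sf sF cp; apply/rowP => k.
rewrite vdE mxE [in X in _ = X + _]mxE [in X in _ = _ + X]mxE vdE -pdM.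
- by apply: pd_ext => // q _; rewrite mxE.
- exact: chart_smooth_diff.
- exact: chart_smooth_diff.
- exact: cmapK.
Qed.

Lemma vdN i F p : chart_smoothv F -> cdom c p ->
  vd i (fun q => - F q) p = - vd i F p.
Proof.
move=> sF cp; apply/rowP => k; rewrite vdE [RHS]mxE vdE -pdN//.
- by apply: pd_ext => // q _; rewrite mxE.
- exact: chart_smooth_diff.
Qed.

Variable B : 'M[R]_n.

Lemma chart_smooth_sprod F G : chart_smoothv F -> chart_smoothv G ->
  chart_smooth (fun p => sprod B (F p) (G p)).
Proof.
move=> sF sG.
have s : chart_smooth (fun p => \sum_k \sum_l F p 0 k * B k l * G p 0 l).
  apply: chart_smooth_sum => k; apply: chart_smooth_sum => l.
  apply: chart_smoothM => //; apply: chart_smoothM => //.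
  exact: chart_smooth_cst.
by apply: eq_chart_smooth s => p _; rewrite sprodE.
Qed.

Lemma pd_sprod i F G p : chart_smoothv F -> chart_smoothv G -> cdom c p ->
  pd c i (fun q => sprod B (F q) (G q)) p =
  sprod B (vd i F p) (G p) + sprod B (F p) (vd i G p).
Proof.
move=> sF sG cp.
have sB k l := chart_smooth_cst (B k l).
rewrite !sprodE -big_split /= (@pd_ext i _
  (fun q => \sum_k \sum_l F q 0 k * B k l * G q 0 l)) //; last first.
  by move=> q _; rewrite sprodE.
rewrite pd_sum => [|k|//]; last first.
  by apply: chart_smooth_sum => l; do 2![apply: chart_smoothM => //].
apply: eq_bigr => k _; rewrite -big_split /= pd_sum => [|l|//]; last first.
  by do 2![apply: chart_smoothM => //].
apply: eq_bigr => l _; rewrite !vdE pdM ?pdM ?pd_cst ?cmapK//.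
- by rewrite mulr0 addr0.
- exact: chart_smooth_diff.
- exact: chart_smooth_diff.
- by apply: chart_smooth_diff => //; apply: chart_smoothM.
- exact: chart_smooth_diff.
Qed.

End Vectors.

Lemma jac_row n (F : S -> 'rV[R]_n) p i k : jac c F p i k = vd i F p 0 k.
Proof. by rewrite !mxE. Qed.

Lemma first_formE n (B : 'M[R]_n) (F : S -> 'rV[R]_n) p i j :
  first_form B c F p i j = sprod B (vd i F p) (vd j F p).
Proof.
rewrite /first_form /sprod /vd -row_mul tr_row !mxE.
by apply: eq_bigr => k _; rewrite !mxE.
Qed.

End Chart.

(** * Linear algebra *)

Lemma ord2P (i : 'I_2) : i = 0 \/ i = 1.
Proof. by case: i => [[|[|//]] ?]; [left|right]; apply: val_inj. Qed.

Lemma sum2 (V : nmodType) (F : 'I_2 -> V) : \sum_i F i = F 0 + F 1.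
Proof.
by rewrite big_ord_recl big_ord1; congr (_ + F _); apply: val_inj.
Qed.

Lemma lift2_0 : lift 0 (0 : 'I_1) = 1 :> 'I_2.
Proof. exact: val_inj. Qed.

Lemma lift2_1 : lift 1 (0 : 'I_1) = 0 :> 'I_2.
Proof. exact: val_inj. Qed.

Lemma det2 (R : comNzRingType) (A : 'M[R]_2) :
  \det A = A 0 0 * A 1 1 - A 0 1 * A 1 0.
Proof.
rewrite (expand_det_row _ 0) sum2 /cofactor !det_mx11 !mxE lift2_0 lift2_1.
by rewrite expr0 expr1 mul1r mulN1r mulrN.
Qed.

Lemma adj2 (R : comNzRingType) (A : 'M[R]_2) :
  [/\ (\adj A) 0 0 = A 1 1, (\adj A) 0 1 = - A 0 1,
      (\adj A) 1 0 = - A 1 0 & (\adj A) 1 1 = A 0 0].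
Proof.
rewrite !mxE /cofactor !det_mx11 !mxE lift2_0 lift2_1.
by rewrite (_ : (1 + 1)%N = 2%N)// expr0 expr1 sqrrN expr1n !mul1r !mulN1r.
Qed.

Lemma row_free_ker (F : fieldType) (m n : nat) (A : 'M[F]_(m, n)) :
  (forall v : 'rV_m, v *m A = 0 -> v = 0) -> row_free A.
Proof.
move=> A0; rewrite -kermx_eq0; apply/rowV0P => v /sub_kermxP; exact: A0.
Qed.

Section Minkowski.
Variable R : realType.
Notation L4 := 'rV[R]_(1 + 3).
Notation "<< u , v >>" := (sprod (Defs.minkowski R) u v).

Lemma tr_minkowski : (Defs.minkowski R)^T = Defs.minkowski R.
Proof.
rewrite /Defs.minkowski tr_block_mx !trmx0 linearN /= !trmx1.
by [].
Qed.

Lemma minkowski_dot (a b : R) (u v : 'rV[R]_3) :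
  << row_mx a%:M u, row_mx b%:M v >> = - (a * b) + dot u v.
Proof.
rewrite /sprod /Defs.minkowski mul_row_block !mulmx0 addr0 add0r tr_row_mx.
rewrite mul_row_col mulmx1 mulmxN mulmx1 tr_scalar_mx mulNmx -scalar_mxM.
by rewrite !mxE eqxx mulr1n /dot /sprod mulmx1 [in RHS]mxE.
Qed.

(* X, Nu and the rows of J form a basis of L^4, as the Gram matrix is
   invertible. *)
Lemma hyperbolic_frame (X Nu : L4) (J : 'M[R]_(2, 1 + 3)) (V : L4) :
  << X, X >> = -1 -> << Nu, Nu >> = 1 -> << Nu, X >> = 0 ->
  (forall i, << row i J, X >> = 0) -> (forall i, << row i J, Nu >> = 0) ->
  J *m Defs.minkowski R *m J^T \in unitmx ->
  << V, X >> = 0 -> << V, Nu >> = 0 -> (forall i, << V, row i J >> = 0) -> V = 0.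
Proof.
move=> XX NN NX JX JN Ju VX VN VJ.
have Jw (w : L4) (v : 'rV[R]_2) : (forall i, << row i J, w >> = 0) ->
    << v *m J, w >> = 0.
  move=> Jw0; rewrite /sprod -!mulmxA mxE big1// => i _.
  by have := Jw0 i; rewrite /sprod -!mulmxA -row_mul mxE => ->; rewrite mulr0.
(* Pairing a combination with [X], [Nu] and the rows of [J] recovers its coefficients. This gives
   the independence of the frame and, at the end, the vanishing of [V]. *)
have comb (a b : R) (v : 'rV[R]_2) :
    let W := a *: X + b *: Nu + v *m J in
    [/\ << W, X >> = - a, << W, Nu >> = b &
        (forall i, << W, row i J >> = 0) -> v = 0].
  split.
  - by rewrite !sprodDl !sprodZl XX NX Jw//; ring.
  - rewrite !sprodDl !sprodZl NN Jw// (sprodC _ _ tr_minkowski) NX; ring.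
  - move=> W0; suff : v *m (J *m Defs.minkowski R *m J^T) = 0.
      by move/(congr1 (mulmx^~ (invmx (J *m Defs.minkowski R *m J^T))));
        rewrite mulmxK// mul0mx.
    apply/rowP => i; rewrite [RHS]mxE -(W0 i) !sprodDl !sprodZl.
    rewrite !(sprodC _ (row i J) tr_minkowski) JX JN !mulr0 !add0r.
    rewrite (sprodC _ _ tr_minkowski) /sprod tr_row !mulmxA.
    rewrite mxE [RHS]mxE; apply: eq_bigr => k _.
    by rewrite [col _ _ _ _]mxE.
pose M : 'M[R]_(1 + 1 + 2, 1 + 3) := col_mx (col_mx X Nu) J.
have ME (v : 'rV[R]_(1 + 1 + 2)) : exists a b w,
    v = row_mx (row_mx a%:M b%:M) w /\ v *m M = a *: X + b *: Nu + w *m J.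
  exists (lsubmx (lsubmx v) 0 0), (rsubmx (lsubmx v) 0 0), (rsubmx v).
  rewrite -!mx11_scalar !hsubmxK; split=> //.
  rewrite -{1}(hsubmxK v) -{1}(hsubmxK (lsubmx v)) /M !mul_row_col.
  rewrite {1}[lsubmx (lsubmx v)]mx11_scalar {1}[rsubmx (lsubmx v)]mx11_scalar.
  by rewrite !mul_scalar_mx.
have Mfull : row_full M.
  have Mfree : row_free M.
    apply: row_free_ker => v; have [a [b [w [-> ->]]]] := ME v.
    move=> W0; have := comb a b w; rewrite W0 /= => -[].
    rewrite {1 2}/sprod !mul0mx mxE => /esym/eqP; rewrite oppr_eq0 => /eqP->.
    move=> <- ->; first by rewrite !raddf0 !row_mx0.
    by move=> i; rewrite /sprod !mul0mx mxE.
  by move: Mfree; rewrite /row_free /row_full.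
have [v VE] : exists v, V = v *m M.
  by have /submxP := submx_full V Mfull.
have [a [b [w [_ vE]]]] := ME v; rewrite {}vE in VE.
have := comb a b w; rewrite -VE /= VX VN.
move=> [/esym/eqP]; rewrite oppr_eq0 => /eqP a0 b0 /(_ VJ) w0.
by rewrite VE a0 -b0 w0 !scale0r mul0mx !addr0.
Qed.

End Minkowski.

(** * Christoffel symbols and the Gauss equation *)

Section Metric.
Variables (R : realType) (S : surface R) (c : chart R S).
Hypothesis hc : atlas c.
Local Open Scope classical_set_scope.
Implicit Types (f g : S -> R) (i j k l m : 'I_2) (p q : S).

Lemma pd_near i f g p : (\forall x \near c p, f (cinv c x) = g (cinv c x)) ->
  pd c i f p = pd c i g p.
Proof. exact: near_eq_derive. Qed.

Lemma chart_diff_near f g p :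
  (\forall x \near c p, f (cinv c x) = g (cinv c x)) ->
  chart_diff c f p -> chart_diff c g p.
Proof. exact: near_eq_differentiable. Qed.

(** Applied to the determinant of a metric that may degenerate elsewhere in the chart: formulas with
    the inverse metric are then available near [p], which is enough to differentiate them at [p]. *)
Lemma near_cmap_neq0 f p : chart_smooth c f -> cdom c p -> f p != 0 ->
  \forall x \near c p, cdom c (cinv c x) /\ f (cinv c x) != 0.
Proof.
move=> sf cp fp; have cV : (c @` cdom c) (c p) by exists p.
have cf : {for c p, continuous (f \o cinv c)}.
  exact/differentiable_continuous/chart_smooth_diff.
have nf : \forall x \near c p, (f \o cinv c) x != 0.
  by apply: cvgr_neq0 cf _; rewrite /= (cmapK hc).
have nV : \forall x \near c p, cdom c (cinv c x).
  apply: (near_open (cmap_open hc) cV) => _ [q cq <-].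
  by rewrite (cmapK hc).
exact: filterS2 nV nf.
Qed.

Section Christoffel.
Variable g : S -> 'M[R]_2.
Hypothesis sg : forall i j, chart_smooth c (fun q => g q i j).

Lemma chart_smooth_det : chart_smooth c (fun q => \det (g q)).
Proof.
apply: (eq_chart_smooth hc (f := fun q => g q 0 0 * g q 1 1 - g q 0 1 * g q 1 0)).
  by move=> q _; rewrite det2.
by apply: (chart_smoothB hc); apply: (chart_smoothM hc).
Qed.

Lemma chart_smooth_adj i j : chart_smooth c (fun q => (\adj (g q)) i j).
Proof.
have sN k l := chart_smoothN hc (sg k l).
have A q := adj2 (g q).
case: (ord2P i) => ->; case: (ord2P j) => ->.
- by apply: (eq_chart_smooth hc _ (sg 1 1)) => q _; case: (A q).
- by apply: (eq_chart_smooth hc _ (sN 0 1)) => q _; case: (A q).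
- by apply: (eq_chart_smooth hc _ (sN 1 0)) => q _; case: (A q).
- by apply: (eq_chart_smooth hc _ (sg 0 0)) => q _; case: (A q).
Qed.

Lemma chart_diff_invmx i j p : cdom c p -> \det (g p) != 0 ->
  chart_diff c (fun q => invmx (g q) i j) p.
Proof.
move=> cp d0.
apply: (@chart_diff_near (fun q => (\det (g q))^-1 * (\adj (g q)) i j)).
  have := near_cmap_neq0 chart_smooth_det cp d0.
  apply: filterS => x /= [_ dx].
  by rewrite /invmx unitmxE unitfE dx [RHS]mxE.
apply: chart_diffM.
  apply: chart_diffV => //; last exact: (cmapK hc).
  exact: chart_smooth_diff chart_smooth_det cp.
exact: chart_smooth_diff (chart_smooth_adj i j) cp.
Qed.

Lemma chart_diff_christoffel k i j p : cdom c p -> \det (g p) != 0 ->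
  chart_diff c (christoffel c g k i j) p.
Proof.
move=> cp d0.
have -> : christoffel c g k i j = fun q => 2^-1 *
   (invmx (g q) k 0 * (pd c i (fun q => g q j 0) q + pd c j (fun q => g q i 0) q
     - pd c 0 (fun q => g q i j) q) +
    invmx (g q) k 1 * (pd c i (fun q => g q j 1) q + pd c j (fun q => g q i 1) q
     - pd c 1 (fun q => g q i j) q)).
  by apply/funext => q; rewrite /christoffel sum2.
have dT l : chart_diff c (fun q => pd c i (fun q => g q j l) q
    + pd c j (fun q => g q i l) q - pd c l (fun q => g q i j) q) p.
  apply: (chart_smooth_diff _ cp); apply: (chart_smoothB hc).
    by apply: (chart_smoothD hc); apply: (chart_smooth_pd hc).
  exact: (chart_smooth_pd hc).
apply: chart_diffM; first exact: chart_diff_cst.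
by apply: chart_diffD; apply: chart_diffM => //; apply: chart_diff_invmx.
Qed.

Lemma christoffel_lower l i j p : \det (g p) != 0 ->
  \sum_k g p l k * christoffel c g k i j p =
  2^-1 * (pd c i (fun q => g q j l) p + pd c j (fun q => g q i l) p
          - pd c l (fun q => g q i j) p).
Proof.
move=> d0; pose T := \col_l (pd c i (fun q => g q j l) p
  + pd c j (fun q => g q i l) p - pd c l (fun q => g q i j) p).
have -> : \sum_k g p l k * christoffel c g k i j p =
    2^-1 * (g p *m (invmx (g p) *m T)) l 0.
  rewrite [in RHS]mxE mulr_sumr; apply: eq_bigr => k _.
  rewrite /christoffel mulrCA; congr (_ * (_ * _)).
  by rewrite [RHS]mxE; apply: eq_bigr => m _; rewrite [T _ _]mxE.
by rewrite mulKVmx ?unitmxE ?unitfE// [T _ _]mxE.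
Qed.

End Christoffel.

Section FirstForm.
Variables (n : nat) (B : 'M[R]_n) (F : S -> 'rV[R]_n).
Hypotheses (Bs : B^T = B) (sF : chart_smoothv c F).

Let g := first_form B c F.
Notation "<< u , v >>" := (sprod B u v).
Notation d i := (vd c i F).
Notation dd i j := (vd c i (vd c j F)).

Let sd i : chart_smoothv c (d i) := chart_smoothv_vd hc i sF.

Lemma chart_smooth_first_form i j : chart_smooth c (fun q => g q i j).
Proof.
apply: eq_chart_smooth (chart_smooth_sprod hc B (sd i) (sd j)) => // q _.
by rewrite /g first_formE.
Qed.

Let sg := chart_smooth_first_form.

Lemma pd_first_form k i j p : cdom c p ->
  pd c k (fun q => g q i j) p = << dd k i p, d j p >> + << d i p, dd k j p >>.
Proof.
move=> cp; rewrite -(pd_sprod hc) //.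
by apply: pd_ext => // q _; rewrite /g first_formE.
Qed.

(** In the alternating sum of the derivatives of << d_i F, d_j F >> all terms cancel except twice <<
    d_i d_j F, d_l F >>, since second derivatives commute. The Christoffel symbols are thus the
    tangential part of the second derivatives, for any symmetric ambient form [B]. *)
Lemma christoffel_first_form l i j p : cdom c p -> \det (g p) != 0 ->
  \sum_k << d l p, d k p >> * christoffel c g k i j p = << dd i j p, d l p >>.
Proof.
move=> cp d0.
transitivity (\sum_k g p l k * christoffel c g k i j p).
  by apply: eq_bigr => k _; rewrite /g first_formE.
rewrite christoffel_lower// !pd_first_form//.
rewrite (vd_vdC hc j i sF cp) (vd_vdC hc l i sF cp) (vd_vdC hc l j sF cp).
rewrite (sprodC (d j p) _ Bs) (sprodC (d i p) _ Bs).
by field.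
Qed.

Lemma christoffel_first_formC k i j p : cdom c p -> \det (g p) != 0 ->
  christoffel c g k i j p = christoffel c g k j i p.
Proof.
move=> cp d0; have gu : g p \in unitmx by rewrite unitmxE unitfE.
have E : g p *m \col_k christoffel c g k i j p =
         g p *m \col_k christoffel c g k j i p.
  apply/colP => l; rewrite [LHS]mxE [RHS]mxE.
  transitivity << dd i j p, d l p >>.
    rewrite -christoffel_first_form//; apply: eq_bigr => m _.
    by congr (_ * _); [rewrite /g first_formE|rewrite mxE].
  rewrite (vd_vdC hc i j sF cp) -christoffel_first_form//.
  by apply: eq_bigr => m _; congr (_ * _); [rewrite /g first_formE|rewrite mxE].
by have /colP/(_ k) := can_inj (mulKmx gu) E; rewrite !mxE.
Qed.

(** The Gauss equation before any normal vector is chosen. It comes from differentiating << d_i d_j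
    F, d_0 F >> = sum_k g_0k Gamma^k_ij once more, along e_0 for (i, j) = (1, 1) and along e_1 for
    (i, j) = (0, 1). *)
Lemma riemann_first_form p : cdom c p -> \det (g p) != 0 ->
  \sum_l riemann_0_1_1 c g l p * g p l 0 =
  << dd 1 1 p, dd 0 0 p >> - << dd 0 1 p, dd 0 1 p >>
  - (\sum_m christoffel c g m 1 1 p * << dd 0 0 p, d m p >>
     - \sum_m christoffel c g m 0 1 p * << dd 0 1 p, d m p >>).
Proof.
move=> cp d0.
(* The existential quantifiers give opaque names, so that the closing arithmetic sees these terms as
   atoms. *)
have [G GE] : exists G, forall m i j, christoffel c g m i j = G m i j.
  by exists (christoffel c g).
have [D DE] : exists D, forall i j, dd i j p = D i j.
  by exists (fun i j => dd i j p).
have [e eE] : exists e, forall i, d i p = e i by exists (fun i => d i p).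
have [T TE] : exists T, forall a i j, << vd c a (dd i j) p, e 0 >> = T a i j.
  by exists (fun a i j => << vd c a (dd i j) p, e 0 >>).
have T10 : T 1 0 1 = T 0 1 1 by rewrite -!TE (vd_vdC hc 1 0 (sd 1) cp).
have D10 : D 1 0 = D 0 1 by rewrite -!DE (vd_vdC hc 1 0 sF cp).
have gE i j : g p i j = << e i, e j >> by rewrite /g first_formE !eE.
have L k i j : << D i j, e k >> =
    << e k, e 0 >> * G 0 i j p + << e k, e 1 >> * G 1 i j p.
  by rewrite -DE -!eE -!GE -christoffel_first_form// sum2.
have dG m i j : chart_diff c (G m i j) p.
  by rewrite -GE; exact: chart_diff_christoffel.
have dGE a i j : T a i j + << D i j, D a 0 >> =
    (<< D a 0, e 0 >> + << e 0, D a 0 >>) * G 0 i j p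
      + << e 0, e 0 >> * pd c a (G 0 i j) p +
    ((<< D a 0, e 1 >> + << e 0, D a 1 >>) * G 1 i j p
      + << e 1, e 0 >> * pd c a (G 1 i j) p).
  have PE m : << D a 0, e m >> + << e 0, D a m >> = pd c a (fun q => g q 0 m) p.
    by rewrite pd_first_form// !DE !eE.
  rewrite !PE -!gE -TE -!DE -eE.
  rewrite -(pd_sprod hc B a (chart_smoothv_vd hc i (sd j)) (sd 0) cp).
  have dg m : chart_diff c (fun q => g q 0 m) p by exact: chart_smooth_diff.
  have -> : g p 1 0 = g p 0 1 by rewrite !gE sprodC.
  have K := cmapK hc cp.
  rewrite -(pdM a (dg 0) (dG 0 i j) K) -(pdM a (dg 1) (dG 1 i j) K).
  rewrite -pdD; try exact: chart_diffM.
  apply: pd_near.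
  have := near_cmap_neq0 (chart_smooth_det sg) cp d0.
  apply: filterS => x /= [cx dx]; rewrite -christoffel_first_form// sum2.
  by rewrite !GE /g !first_formE.
(* Both instances contain the third derivative [T 0 1 1], because derivatives commute; it cancels in
   E1 - E2, which is the claim. *)
have E1 := dGE 0 1 1; have E2 := dGE 1 0 1.
have RE l : riemann_0_1_1 c g l p =
    pd c 0 (G l 1 1) p - pd c 1 (G l 0 1) p
    + (G 0 1 1 p * G l 0 0 p - G 0 0 1 p * G l 1 0 p
       + (G 1 1 1 p * G l 0 1 p - G 1 0 1 p * G l 1 1 p)).
  by rewrite /riemann_0_1_1 sum2 !GE.
have G10 m : G m 1 0 p = G m 0 1 p by rewrite -!GE christoffel_first_formC.
rewrite !sum2 !RE !gE !GE !DE !eE !G10.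
rewrite T10 D10 in E1 E2.
rewrite !(sprodC (e 0) (D _ _) Bs) !L in E1 E2.
rewrite !L !(sprodC (e 1) (e 0) Bs) in E1 E2 *.
move: E1 E2.
move: (pd c 0 (G 0 1 1) p) (pd c 0 (G 1 1 1) p) => g1 g2.
move: (pd c 1 (G 0 0 1) p) (pd c 1 (G 1 0 1) p) => g3 g4.
move: (G 0 0 0 p) (G 0 0 1 p) (G 0 1 1 p) => h1 h2 h3.
move: (G 1 0 0 p) (G 1 0 1 p) (G 1 1 1 p) => h4 h5 h6.
move: << e 0, e 0 >> << e 0, e 1 >> << e 1, e 1 >> => e1 e2 e3.
move: << D 1 1, D 0 0 >> << D 0 1, D 0 1 >> (T 0 1 1) => x1 x2 t.
lra.
Qed.

End FirstForm.

Section Hyperbolic.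
Variables (X Nu : S -> 'rV[R]_(1 + 3)).
Hypotheses (sX : chart_smoothv c X) (sN : chart_smoothv c Nu).

Notation B := (Defs.minkowski R).
Notation "<< u , v >>" := (sprod B u v).
Notation d i := (vd c i X).
Notation dd i j := (vd c i (vd c j X)).

Hypothesis XX : forall q, cdom c q -> << X q, X q >> = -1.
Hypothesis NN : forall q, cdom c q -> << Nu q, Nu q >> = 1.
Hypothesis NX : forall q, cdom c q -> << Nu q, X q >> = 0.
Hypothesis dXN : forall i q, cdom c q -> << d i q, Nu q >> = 0.

Lemma vd_hyperboloid i q : cdom c q -> << d i q, X q >> = 0.
Proof.
move=> cq; have := pd_sprod hc B i sX sX cq.
rewrite (pd_ext hc i (g := fun=> -1) cq)// pd_cst.
by rewrite (sprodC (X q) _ (tr_minkowski R)) => /esym; lra.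
Qed.

Let g := first_form B c X.
Let h i j p := << d i p, vd c j Nu p >>.

(** The normal components come from differentiating <<dX, X>> = 0 and <<dX, Nu>> = 0. The term in
    [X] has a plus sign because <<X, X>> = -1. The form [h] is minus the second fundamental form. *)
Lemma hyperbolic_gauss_formula i j p : cdom c p -> \det (g p) != 0 ->
  dd i j p = \sum_k christoffel c g k i j p *: d k p - h j i p *: Nu p
             + g p i j *: X p.
Proof.
move=> cp d0.
have sd := chart_smoothv_vd hc j sX.
have ddX : << dd i j p, X p >> = - g p i j.
  have := pd_sprod hc B i sd sX cp.
  rewrite (pd_ext hc i (g := fun=> 0) cp) => [|q]; last exact: vd_hyperboloid.
  rewrite pd_cst => /esym/eqP; rewrite addr_eq0 => /eqP ->.
  by rewrite /g first_formE (sprodC _ _ (tr_minkowski R)).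
have ddN : << dd i j p, Nu p >> = - h j i p.
  have := pd_sprod hc B i sd sN cp.
  rewrite (pd_ext hc i (g := fun=> 0) cp) => [|q]; last exact: dXN.
  by rewrite pd_cst => /esym/eqP; rewrite addr_eq0 => /eqP.
apply/eqP; rewrite -subr_eq0; apply/eqP.
have rowJ k : row k (jac c X p) = d k p by [].
have dk0 (w : 'rV[R]_(1 + 3)) : (forall k, << d k p, w >> = 0) ->
    << \sum_k christoffel c g k i j p *: d k p, w >> = 0.
  by move=> dw; rewrite sum2 sprodDl !sprodZl !dw !mulr0 addr0.
apply: (hyperbolic_frame (XX cp) (NN cp) (NX cp)
  (fun k => vd_hyperboloid k cp) (fun k => dXN k cp)).
- by rewrite unitmxE unitfE.
- rewrite sprodBl sprodDl sprodBl !sprodZl dk0 => [|k]; last exact: vd_hyperboloid.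
  by rewrite ddX XX// NX//; ring.
- rewrite sprodBl sprodDl sprodBl !sprodZl dk0 => [|k]; last exact: dXN.
  by rewrite ddN NN// (sprodC _ _ (tr_minkowski R)) NX//; ring.
- move=> k; rewrite rowJ sprodBl sprodDl sprodBl !sprodZl.
  rewrite (sprodC (Nu p) _ (tr_minkowski R)) dXN//.
  rewrite (sprodC (X p) _ (tr_minkowski R)) vd_hyperboloid// !mulr0 subr0 addr0.
  rewrite -(christoffel_first_form (tr_minkowski R) sX _ _ _ cp d0).
  rewrite !sum2 sprodDl !sprodZl !(sprodC _ (d k p) (tr_minkowski R)).
  by ring.
Qed.

(** The curvature is - 1 + det h / det g, where - 1 comes from the ambient space. *)
Lemma hyperbolic_flat p : cdom c p ->
  h 0 0 p * h 1 1 p - h 0 1 p * h 1 0 p = \det (g p) ->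
  gauss_curvature c g p = 0.
Proof.
move=> cp deth; rewrite /gauss_curvature.
(* Where the metric degenerates, the quotient defining the curvature is 0 by the convention for
   division by 0. *)
have [->|d0] := eqVneq (\det (g p)) 0; first by rewrite invr0 mulr0.
rewrite (riemann_first_form (tr_minkowski R) sX cp d0).
(* The Christoffel sums produced here are exactly the ones subtracted in [riemann_first_form]. *)
have E i j k l : << dd i j p, dd k l p >> =
    \sum_m christoffel c g m i j p * << dd k l p, d m p >>
    + h j i p * h l k p - g p i j * g p k l.
  rewrite {1}hyperbolic_gauss_formula// sprodDl sprodBl !sprodZl.
  rewrite (sprodC (Nu p) _ (tr_minkowski R)) (sprodC (X p) _ (tr_minkowski R)).
  rewrite !sum2 sprodDl !sprodZl !(sprodC (d _ p) (dd _ _ p) (tr_minkowski R)).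
  have dkN : << \sum_m christoffel c g m k l p *: d m p, Nu p >> = 0.
    by rewrite sum2 sprodDl !sprodZl !dXN// !mulr0 addr0.
  have dkX : << \sum_m christoffel c g m k l p *: d m p, X p >> = 0.
    by rewrite sum2 sprodDl !sprodZl !vd_hyperboloid// !mulr0 addr0.
  rewrite [Y in << Y, Nu p >>]hyperbolic_gauss_formula//.
  rewrite [Y in << Y, X p >>]hyperbolic_gauss_formula//.
  rewrite !sprodDl !sprodNl !sprodZl dkN dkX NN// NX// XX//.
  by rewrite (sprodC (X p) _ (tr_minkowski R)) NX//; ring.
have hC : h 0 1 p = h 1 0 p.
  have := hyperbolic_gauss_formula 0 1 cp d0.
  move/(congr1 (fun v => << v, Nu p >>)).
  rewrite (vd_vdC hc 0 1 sX cp) (hyperbolic_gauss_formula 1 0 cp d0).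
  rewrite !sum2 !sprodDl !sprodNl !sprodZl !dXN// NN//.
  rewrite (sprodC (X p) _ (tr_minkowski R)) NX//; lra.
rewrite E (E 0 1) -/g; apply/eqP; rewrite mulf_eq0; apply/orP; left; apply/eqP.
have gC : g p 1 0 = g p 0 1 by rewrite /g !first_formE (sprodC _ _ (tr_minkowski R)).
move: deth; rewrite det2 gC hC => deth.
by move: (\sum_m _) (\sum_m _) => r1 r2; lra.
Qed.

End Hyperbolic.
End Metric.

(** * Normalized pairs *)

Section Euclidean.
Variables (R : realType) (n : nat).
Implicit Types u v w : 'rV[R]_n.

Lemma dotnE u v : sprod 1%:M u v = \sum_k u 0 k * v 0 k.
Proof. by rewrite /sprod mulmx1 mxE; apply: eq_bigr => k _; rewrite mxE. Qed.

Lemma dotnC u v : sprod 1%:M u v = sprod 1%:M v u.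
Proof. exact/sprodC/trmx1. Qed.

Lemma dotn_eq0 u : sprod 1%:M u u = 0 -> u = 0.
Proof.
rewrite dotnE => /eqP; rewrite psumr_eq0 => [/allP u0|k _]; last exact: sqr_ge0.
apply/rowP => k; rewrite mxE; apply/eqP.
by have := u0 k (mem_index_enum k); rewrite /= mulf_eq0 orbb.
Qed.

(** A vector v in the kernel of the Gram matrix satisfies |v J|^2 = 0. *)
Lemma gram_unit m (J : 'M[R]_(m, n)) : row_free J ->
  J *m 1%:M *m J^T \in unitmx.
Proof.
move=> Jf; rewrite -row_free_unit; apply: row_free_ker => v v0.
suff /eqP : v *m J = 0 by rewrite mulmx_free_eq0// => /eqP.
apply: dotn_eq0; rewrite /sprod trmx_mul !mulmxA.
by rewrite -(mulmxA v) -(mulmxA v) v0 mul0mx mxE.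
Qed.

End Euclidean.

(** The normal and the rows of [J] form a basis. Vector identities along an immersion are proved
    below by pairing both sides with this basis. *)
Lemma euclidean_frame (R : realType) (Nu V : 'rV[R]_3) (J : 'M[R]_(2, 3)) :
  row_free J -> sprod 1%:M Nu Nu = 1 ->
  (forall i, sprod 1%:M (row i J) Nu = 0) ->
  sprod 1%:M V Nu = 0 -> (forall i, sprod 1%:M V (row i J) = 0) -> V = 0.
Proof.
move=> Jf NN JN VN VJ.
have Jw (w : 'rV[R]_3) (v : 'rV[R]_2) :
    (forall i, sprod 1%:M (row i J) w = 0) -> sprod 1%:M (v *m J) w = 0.
  move=> Jw0; rewrite /sprod -!mulmxA mxE big1// => i _.
  by have := Jw0 i; rewrite /sprod -!mulmxA -row_mul mxE => ->; rewrite mulr0.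
pose M : 'M[R]_(1 + 2, 3) := col_mx Nu J.
have ME (v : 'rV[R]_(1 + 2)) :
    v *m M = (lsubmx v) 0 0 *: Nu + rsubmx v *m J.
  by rewrite -{1}(hsubmxK v) mul_row_col {1}[lsubmx v]mx11_scalar mul_scalar_mx.
have Mfull : row_full M.
  have Mfree : row_free M.
    apply: row_free_ker => v; rewrite ME => v0.
    have l0 : (lsubmx v) 0 0 = 0.
      have := congr1 (fun w => sprod 1%:M w Nu) v0.
      by rewrite sprodDl sprodZl NN Jw// mulr1 addr0 => ->; rewrite /sprod !mul0mx mxE.
    move/eqP: v0; rewrite l0 scale0r add0r mulmx_free_eq0// => /eqP r0.
    rewrite -(hsubmxK v) r0 [lsubmx v]mx11_scalar l0.
    by rewrite raddf0 row_mx0.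
  by move: Mfree; rewrite /row_free /row_full.
have [v VE] : exists v, V = v *m M by have /submxP := submx_full V Mfull.
apply: dotn_eq0; rewrite {1}VE ME sprodDl sprodZl dotnC VN mulr0 add0r Jw// => i.
by rewrite dotnC.
Qed.

Section Surface.
Variables (R : realType) (S : surface R).
Local Open Scope classical_set_scope.
Implicit Types (c : chart R S) (p : S) (Z N X : S -> 'rV[R]_3) (rho phi : S -> R).

Notation "<< u , v >>" := (sprod 1%:M u v).

Lemma chart_atP p : atlas (chart_at p) /\ cdom (chart_at p) p.
Proof. exact: projT2 (cid (atlas_cover p)). Qed.

Lemma jac_dot n c (B : 'M[R]_n) (F : S -> 'rV[R]_n) p (w : 'rV[R]_n) i :
  (jac c F p *m B *m w^T) i 0 = sprod B (vd c i F p) w.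
Proof. by rewrite /sprod /vd -!row_mul [RHS]mxE. Qed.

Lemma jac_tangent n c (B : 'M[R]_n) (F : S -> 'rV[R]_n) p (w : 'rV[R]_n) :
  jac c F p *m B *m w^T = 0 <-> forall i, sprod B (vd c i F p) w = 0.
Proof.
split=> [j0 i|j0]; first by rewrite -jac_dot j0 mxE.
by apply/colP => i; rewrite jac_dot j0 mxE.
Qed.

Lemma dot_jac c (F : S -> 'rV[R]_3) p (w : 'rV[R]_3) i :
  (w *m (jac c F p)^T) 0 i = << w, vd c i F p >>.
Proof.
rewrite dotnE mxE; apply: eq_bigr => k _.
by rewrite [X in _ = _ * X]mxE [X in _ * X = _]mxE.
Qed.

Lemma pd_unit c i N p : atlas c -> cdom c p -> smoothv N ->
  (forall q, << N q, N q >> = 1) -> << vd c i N p, N p >> = 0.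
Proof.
move=> ca cp sN NN; have sNc : chart_smoothv c N by move=> k; apply: sN.
have := pd_sprod ca 1%:M i sNc sNc cp.
rewrite (pd_ext ca i (g := fun=> 1) cp)// pd_cst (dotnC (N p)) => /esym; lra.
Qed.

(** Differentiate <dZ, N> = 0; the symmetry is that of the second derivatives of [Z]. *)
Lemma shape_symmetric c i j Z N p : atlas c -> cdom c p ->
  smoothv Z -> smoothv N ->
  (forall k q, cdom c q -> << vd c k Z q, N q >> = 0) ->
  << vd c i (vd c j Z) p, N p >> = - << vd c i N p, vd c j Z p >> /\
  << vd c i N p, vd c j Z p >> = << vd c j N p, vd c i Z p >>.
Proof.
move=> ca cp sZ sN ZN.
have sZc : chart_smoothv c Z by move=> k; apply: sZ.
have sNc : chart_smoothv c N by move=> k; apply: sN.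
have E k l : << vd c k (vd c l Z) p, N p >> = - << vd c k N p, vd c l Z p >>.
  have := pd_sprod ca 1%:M k (chart_smoothv_vd ca l sZc) sNc cp.
  rewrite (pd_ext ca k (g := fun=> 0) cp) => [|q cq]; last exact: ZN.
  by rewrite pd_cst (dotnC (vd c l Z p)) => /esym/eqP; rewrite addr_eq0 => /eqP.
split=> //; have := E j i.
by rewrite (vd_vdC ca j i sZc cp) E => /oppr_inj.
Qed.

(** [grad] is computed in a chosen chart; this characterizes it as the tangent vector that
    represents df, so that the choice disappears. *)
Lemma grad_unique Z N (f : S -> R) p (w : 'rV[R]_3) : immersed_at Z p ->
  << N p, N p >> = 1 ->
  (forall c i, atlas c -> cdom c p -> << vd c i Z p, N p >> = 0) ->
  << w, N p >> = 0 ->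
  (forall c i, atlas c -> cdom c p -> << w, vd c i Z p >> = pd c i f p) ->
  grad Z f p = w.
Proof.
move=> Zi NN ZN wN wZ; have [ca cp] := chart_atP p; rewrite /grad.
set c := chart_at p in ca cp *.
have Jf := Zi c ca cp.
apply/eqP; rewrite -subr_eq0; apply/eqP.
apply: (euclidean_frame Jf NN (fun i => ZN c i ca cp)).
  rewrite sprodBl wN subr0 /sprod mulmx1 -mulmxA.
  have -> : jac c Z p *m (N p)^T = 0.
    by have := (jac_tangent c 1%:M Z p (N p)).2 (fun i => ZN c i ca cp); rewrite mulmx1.
  by rewrite mulmx0 mxE.
move=> i; rewrite sprodBl -/(vd c i Z p) (wZ c i ca cp).
rewrite -dot_jac /formI /first_form mulmx1 -mulmxA mulmxKV.
  by rewrite mxE subrr.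
by have := gram_unit Jf; rewrite mulmx1.
Qed.

(* The data of a normalized Ribaucour pair (Z - (2 / rho) X, N - (2 / phi) X)
   of Z, N; this form of the equations is stable under exchanging the two
   surfaces. *)
Record normalized_pair Z N X rho phi : Prop := NormalizedPair {
  np_Z : smoothv Z;
  np_N : smoothv N;
  np_X : smoothv X;
  np_rho : smooth rho;
  np_phi : smooth phi;
  np_rho0 : forall p, rho p != 0;
  np_phi0 : forall p, phi p != 0;
  np_NN : forall p, << N p, N p >> = 1;
  np_XN : forall p, << X p, N p >> = rho p;
  np_XX : forall p, << X p, X p >> = rho p * phi p;
  np_ZN : forall c p i, atlas c -> cdom c p -> << vd c i Z p, N p >> = 0;
  np_drho : forall c p i, atlas c -> cdom c p ->
    << X p, vd c i N p >> = pd c i rho p;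
  np_dphi : forall c p i, atlas c -> cdom c p ->
    << X p, vd c i Z p >> = pd c i phi p;
  np_dX : forall c p i, atlas c -> cdom c p ->
    vd c i X p = 2^-1 *: (rho p *: vd c i Z p + phi p *: vd c i N p) }.

Lemma grad_normalized_pair Z N X rho phi p : immersed_at Z p ->
  normalized_pair Z N X rho phi -> grad Z phi p = X p - rho p *: N p.
Proof.
move=> Zi h; apply: (grad_unique Zi (np_NN h p)).
- by move=> c i ca cp; exact: (np_ZN h).
- by rewrite sprodBl sprodZl (np_XN h) (np_NN h) mulr1 subrr.
- move=> c i ca cp; rewrite sprodBl sprodZl (dotnC (N p)) (np_ZN h)//.
  by rewrite mulr0 subr0 (np_dphi h).
Qed.

Lemma gauss_formula c i j Z N p : atlas c -> cdom c p ->
  smoothv Z -> smoothv N -> immersed_at Z p -> << N p, N p >> = 1 ->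
  (forall k q, cdom c q -> << vd c k Z q, N q >> = 0) ->
  vd c i (vd c j Z) p = \sum_k christoffel c (formI c Z) k i j p *: vd c k Z p
    - << vd c i N p, vd c j Z p >> *: N p.
Proof.
move=> ca cp sZ sN Zi NN ZN.
have sZc : chart_smoothv c Z by move=> k; apply: sZ.
have d0 : \det (first_form 1%:M c Z p) != 0.
  by rewrite -unitfE -unitmxE; exact: gram_unit (Zi c ca cp).
apply/eqP; rewrite -subr_eq0; apply/eqP.
apply: (euclidean_frame (Zi c ca cp) NN (fun i => ZN i p cp)).
  rewrite !sprodBl sprodZl NN (shape_symmetric i j ca cp sZ sN ZN).1.
  by rewrite sum2 sprodDl !sprodZl !ZN//; ring.
move=> k; rewrite -/(vd c k Z p) !sprodBl sprodZl (dotnC (N p)) ZN//.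
rewrite -(christoffel_first_form ca (trmx1 _ _) sZc _ _ _ cp d0).
rewrite !sum2 sprodDl !sprodZl !(dotnC _ (vd c k Z p)) /formI.
by ring.
Qed.

Lemma formIIE c Z N p i j : formII c Z N p i j = - << vd c i Z p, vd c j N p >>.
Proof.
rewrite mxE; congr (- _); rewrite dotnE mxE.
by apply: eq_bigr => k _; rewrite !vdE !mxE.
Qed.

(* The tangential part of dX is Hess(phi) - rho II. *)
Lemma normalized_pairP Z N Zt Nt rho phi :
  minimal_normalized_ribaucour_pair Z N Zt Nt ->
  ribaucour_data Z N Zt Nt rho phi ->
  exists X, [/\ normalized_pair Z N X rho phi,
    forall p, Zt p = Z p - (2 / rho p) *: X p &
    forall p, Nt p = N p - (2 / phi p) *: X p].
Proof.
move=> [_ [[sZ sN NN ZN0] [_ Zi] _ _] _ norm] data.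
have eqs := norm _ _ data.
move: data => [srho sphi rho0 [X [[sX _ _ XN0] rhoE dE ZtE NtE]]].
have ZN c p i : atlas c -> cdom c p -> << vd c i Z p, N p >> = 0.
  by move=> ca cp; apply/jac_tangent: i; exact: ZN0.
have dXN c p i : atlas c -> cdom c p -> << vd c i X p, N p >> = 0.
  by move=> ca cp; apply/jac_tangent: i; exact: XN0.
have drho c p i : atlas c -> cdom c p -> << X p, vd c i N p >> = pd c i rho p.
  by move=> ca cp; rewrite -dot_jac -(dE c p ca cp).1 mxE.
have dphi c p i : atlas c -> cdom c p -> << X p, vd c i Z p >> = pd c i phi p.
  by move=> ca cp; rewrite -dot_jac -(dE c p ca cp).2 mxE.
have gradE p : grad Z phi p = X p - rho p *: N p.
  apply: (grad_unique (Zi p) (NN p)).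
  - by move=> c i; exact: ZN.
  - by rewrite sprodBl sprodZl -[X in X - _]rhoE NN mulr1 subrr.
  - move=> c i ca cp; rewrite sprodBl sprodZl (dotnC (N p)) ZN// dphi//.
    by rewrite mulr0 subr0.
have XX p : << X p, X p >> = rho p * phi p.
  have [ca cp] := chart_atP p; have [_ _] := eqs _ _ ca cp.
  rewrite gradE /dot sprodBl !sprodBr !sprodZl !sprodZr NN (dotnC (N p)).
  by rewrite -[<< X p, N p >>]rhoE; lra.
(* A zero of phi would be a zero of X, and there rho = <X, N> would vanish as well. *)
have phi0 p : phi p != 0.
  apply/eqP => phi0; move: (XX p); rewrite phi0 mulr0 => /dotn_eq0 X0.
  by move: (rho0 p); rewrite rhoE X0 /dot /sprod !mul0mx mxE eqxx.
exists X; split; last 2 first.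
- move=> p; rewrite ZtE /dot XX; congr (_ - _ *: _).
  by field; rewrite rho0 phi0.
- move=> p; rewrite NtE /dot XX; congr (_ - _ *: _).
  by field; rewrite rho0 phi0.
split=> // c p i ca cp.
(* Both sides are tangent to [Z], so it remains to pair them with d_j Z. For this, d_j phi = <X, d_j
   Z> is differentiated along e_i: the tangential part of d_i d_j Z turns the second derivative of
   phi into the Hessian, and its normal part contributes the term with rho. *)
apply/eqP; rewrite -subr_eq0; apply/eqP.
apply: (euclidean_frame (Zi p c ca cp) (NN p) (fun i => ZN c p i ca cp)).
  rewrite sprodBl !sprodZl sprodDl !sprodZl dXN// ZN// (pd_unit _ ca)//.
  by rewrite !mulr0 addr0 mulr0 subr0.
move=> j; rewrite -/(vd c j Z p).
have sZc : chart_smoothv c Z by move=> k; apply: sZ.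
have sXc : chart_smoothv c X by move=> k; apply: sX.
have := pd_sprod ca 1%:M i sXc (chart_smoothv_vd ca j sZc) cp.
rewrite (pd_ext ca i (g := pd c j phi) cp) => [|q cq]; last exact: dphi.
have ZNc k q : cdom c q -> << vd c k Z q, N q >> = 0 by move=> cq; exact: ZN.
rewrite (gauss_formula i j ca cp sZ sN (Zi p) (NN p) ZNc).
have [_ hessE _] := eqs c p ca cp.
have := congr1 (fun M : 'M[R]_2 => M i j) hessE.
rewrite [X in X = _ -> _]mxE [X in _ = X -> _]mxE.
rewrite [X in _ = X + _ -> _]mxE [X in _ = _ + X -> _]mxE formIIE.
rewrite [formI _ _ _ _ _]first_formE !sum2.
rewrite sprodBr sprodDr !sprodZr !dphi// sprodBl !sprodZl sprodDl !sprodZl.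
rewrite -[<< X p, N p >>]rhoE.
rewrite (dotnC (vd c i Z p) (vd c j N p)).
rewrite -(shape_symmetric i j ca cp sZ sN ZNc).2.
move: << vd c i N p, vd c j Z p >> << vd c i Z p, vd c j Z p >> => a b.
move: << vd c i X p, vd c j Z p >> => x1.
move: (christoffel _ _ 0 i j p * _ + christoffel _ _ 1 i j p * _) => x2.
move: (pd c i (pd c j phi) p) (rho p) (phi p) => x3 x4 x5.
by lra.
Qed.

Lemma smoothv_row_mx n1 n2 (F : S -> 'rV[R]_n1) (G : S -> 'rV[R]_n2) :
  smoothv F -> smoothv G -> smoothv (fun p => row_mx (F p) (G p)).
Proof.
move=> sF sG k; case: (split_ordP k) => l ->.
  by have := sF l; congr (smooth _); apply/funext => p; rewrite row_mxEl.
by have := sG l; congr (smooth _); apply/funext => p; rewrite row_mxEr.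
Qed.

Lemma jac_row_mx n1 n2 c (F : S -> 'rV[R]_n1) (G : S -> 'rV[R]_n2) p :
  jac c (fun q => row_mx (F q) (G q)) p = row_mx (jac c F p) (jac c G p).
Proof.
apply/matrixP => i k; rewrite mxE; case: (split_ordP k) => l ->.
  by rewrite row_mxEl mxE; congr (pd _ _ _ _); apply/funext => q; exact: row_mxEl.
by rewrite row_mxEr mxE; congr (pd _ _ _ _); apply/funext => q; exact: row_mxEr.
Qed.

Lemma smoothvB_scaled (f : S -> R) (F G : S -> 'rV[R]_3) :
  smooth f -> smoothv F -> smoothv G -> smoothv (fun p => F p - f p *: G p).
Proof.
move=> sf sF sG k c ca.
have sGc : chart_smoothv c G by move=> l; apply: sG.
have sFc : chart_smoothv c F by move=> l; apply: sF.
apply: (chart_smoothvD ca sFc); apply: (chart_smoothvN ca).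
exact: (chart_smoothvZ ca (sf c ca) sGc).
Qed.

(** * Exchanging the two surfaces *)

Section Dual.
Variables (Z N X : S -> 'rV[R]_3) (rho phi : S -> R).
Hypothesis h : normalized_pair Z N X rho phi.

Definition dualZ p := Z p - (2 / rho p) *: X p.
Definition dualN p := N p - (2 / phi p) *: X p.
(** Minus the inversion of X in the unit sphere. The reflection that takes N to N~ reverses X; the
    sign compensates this, so that <X~, N~> = 1 / phi. *)
Definition dualX p := (- (rho p * phi p)^-1) *: X p.

Lemma smooth_inv (f : S -> R) : (forall p, f p != 0) -> smooth f ->
  smooth (fun p => (f p)^-1).
Proof. by move=> f0 sf c ca; apply: (chart_smoothV ca _ (sf c ca)) => p _. Qed.

Lemma smooth_div2 (f : S -> R) : (forall p, f p != 0) -> smooth f ->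
  smooth (fun p => 2 / f p).
Proof.
move=> f0 sf c ca; apply: (chart_smoothM ca); first exact: chart_smooth_cst.
exact: smooth_inv.
Qed.

Lemma pd_inv c i (f : S -> R) p : atlas c -> cdom c p -> smooth f -> f p != 0 ->
  pd c i (fun q => (f q)^-1) p = - (pd c i f p * (f p)^-1 * (f p)^-1).
Proof.
move=> ca cp sf f0; apply: pdV => //; last exact: (cmapK ca).
exact: chart_smooth_diff (sf c ca) cp.
Qed.

Lemma vd_sub_div c i (f : S -> R) (F : S -> 'rV[R]_3) p : atlas c ->
  cdom c p -> smooth f -> (forall q, f q != 0) -> smoothv F ->
  vd c i (fun q => F q - (2 / f q) *: X q) p =
  vd c i F p - (2 / f p) *: vd c i X p + (2 * pd c i f p / f p ^+ 2) *: X p.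
Proof.
move=> ca cp sf f0 sF.
have sFc : chart_smoothv c F by move=> k; apply: sF.
have sXc : chart_smoothv c X by move=> k; apply: (np_X h).
have sfc := smooth_div2 f0 sf ca.
have sZc := chart_smoothvZ ca sfc sXc.
rewrite (vdD ca i sFc (chart_smoothvN ca sZc) cp) (vdN ca i sZc cp).
rewrite (vdZ ca i sfc sXc cp) pdM; first last.
- exact: (cmapK ca).
- exact: chart_smooth_diff (smooth_inv f0 sf ca) cp.
- exact: chart_diff_cst.
rewrite pd_cst mul0r add0r pd_inv//.
apply/rowP => k; rewrite !mxE expr2 invfM; ring.
Qed.

(* dN~ is, up to the factor - rho / phi, the reflection of dZ along X *)
Lemma vd_dualN c i p : atlas c -> cdom c p ->
  vd c i dualN p = - (rho p / phi p) *: vd c i Z p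
    + (2 * << X p, vd c i Z p >> / phi p ^+ 2) *: X p.
Proof.
move=> ca cp; rewrite /dualN (vd_sub_div i ca cp (np_phi h) (np_phi0 h) (np_N h)).
rewrite (np_dX h)// (np_dphi h)//.
by apply/rowP => k; rewrite !mxE; field; exact: np_phi0 h p.
Qed.

Lemma vd_dualZ c i p : atlas c -> cdom c p ->
  vd c i dualZ p = - (phi p / rho p) *: vd c i N p
    + (2 * << X p, vd c i N p >> / rho p ^+ 2) *: X p.
Proof.
move=> ca cp; rewrite /dualZ (vd_sub_div i ca cp (np_rho h) (np_rho0 h) (np_Z h)).
rewrite (np_dX h)// (np_drho h)//.
by apply/rowP => k; rewrite !mxE; field; exact: np_rho0 h p.
Qed.

(** As 1 / phi plays the part of rho and 1 / rho that of phi, the exchange is an involution; results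
    for [Z] therefore pass to the second surface. *)
Lemma dual_dual p : dualZ p - (2 / (phi p)^-1) *: dualX p = Z p /\
  dualN p - (2 / (rho p)^-1) *: dualX p = N p.
Proof.
rewrite /dualZ /dualN /dualX; have r0 := np_rho0 h p; have f0 := np_phi0 h p.
by split; apply/rowP => k; rewrite !mxE; field; rewrite r0 f0.
Qed.

Lemma normalized_pair_dual :
  (forall c p i, atlas c -> cdom c p -> << vd c i dualZ p, dualN p >> = 0) ->
  normalized_pair dualZ dualN dualX (fun p => (phi p)^-1) (fun p => (rho p)^-1).
Proof.
move=> dZN.
have r0 := np_rho0 h; have f0 := np_phi0 h.
have rf0 p : rho p * phi p != 0 by rewrite mulf_neq0.
have srf : smooth (fun p => rho p * phi p).
  by move=> c ca; apply: (chart_smoothM ca (np_rho h ca) (np_phi h ca)).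
have sg : smooth (fun p => - (rho p * phi p)^-1).
  move=> c ca; apply: (chart_smoothN ca); exact: smooth_inv rf0 srf c ca.
split=> //.
- exact: smoothvB_scaled (smooth_div2 r0 (np_rho h)) (np_Z h) (np_X h).
- exact: smoothvB_scaled (smooth_div2 f0 (np_phi h)) (np_N h) (np_X h).
- move=> k c ca; apply: (chart_smoothvZ ca (sg c ca)) => l; exact: (np_X h).
- exact: smooth_inv (np_phi h).
- exact: smooth_inv (np_rho h).
- by move=> p; rewrite invr_neq0.
- by move=> p; rewrite invr_neq0.
- move=> p; rewrite sprodBl !sprodBr !sprodZl !sprodZr (np_NN h) (dotnC (N p)).
  by rewrite (np_XN h) (np_XX h); field.
- move=> p; rewrite sprodBr sprodZr !sprodZl (np_XN h) (np_XX h).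
  by field; rewrite r0 f0.
- move=> p; rewrite sprodZr !sprodZl (np_XX h).
  by field; rewrite r0 f0.
- move=> c p i ca cp; rewrite vd_dualN// sprodDr !sprodZr !sprodZl (np_XX h).
  rewrite (np_dphi h)// pd_inv//; first by field; rewrite r0 f0.
  exact: np_phi h.
- move=> c p i ca cp; rewrite vd_dualZ// sprodDr !sprodZr !sprodZl (np_XX h).
  rewrite (np_drho h)// pd_inv//; first by field; rewrite r0 f0.
  exact: np_rho h.
- move=> c p i ca cp; rewrite vd_dualZ// vd_dualN// (np_dphi h)// (np_drho h)//.
  have sXc : chart_smoothv c X by move=> k; apply: (np_X h).
  rewrite (vdZ ca i (sg c ca) sXc cp) pdN//; last first.
    exact: chart_smooth_diff (smooth_inv rf0 srf ca) cp.
  rewrite (pd_inv i ca cp srf (rf0 p)) pdM; first last.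
  - exact: (cmapK ca).
  - exact: chart_smooth_diff (np_phi h ca) cp.
  - exact: chart_smooth_diff (np_rho h ca) cp.
  rewrite (np_dX h)//.
  by apply/rowP => k; rewrite !mxE; field; rewrite r0 f0.
Qed.

(** dZ~ is obtained from dN by a linear map of R^3, so the kernel of dN is contained in that of
    dZ~. *)
Lemma immersed_gauss_map p : immersed_at dualZ p -> immersed_at N p.
Proof.
move=> Zi c ca cp; apply: row_free_ker => v v0.
suff /eqP : v *m jac c dualZ p = 0.
  by rewrite mulmx_free_eq0 ?Zi// => /eqP.
have -> : jac c dualZ p = - (phi p / rho p) *: jac c N p
    + (2 / rho p ^+ 2) *: (jac c N p *m (X p)^T *m X p).
  apply/row_matrixP => i; rewrite -/(vd c i dualZ p) vd_dualZ//.
  rewrite linearD !linearZ /= -!/(vd c i _ p); congr (_ + _).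
  rewrite !row_mul [row i _ *m _]mx11_scalar mul_scalar_mx scalerA; congr (_ *: _).
  rewrite dotnC /sprod mulmx1 -/(vd c i N p); ring.
rewrite mulmxDr -!scalemxAr !mulmxA v0 !mul0mx !scaler0 addr0.
by [].
Qed.

(** As 2 dX = rho dZ + phi dN, a direction killed by both dX and dN is killed by rho dZ, and rho has
    no zero. *)
Lemma front_normalized_pair : (forall p, immersed_at Z p) -> front3 X N.
Proof.
move=> Zi; split; first split.
- exact: np_X h.
- exact: np_N h.
- exact: np_NN h.
- move=> c p ca cp; apply/jac_tangent => i.
  rewrite (np_dX h)// sprodZl sprodDl !sprodZl (np_ZN h)//.
  by rewrite (pd_unit _ ca cp (np_N h) (np_NN h)) !mulr0 addr0 mulr0.
split.
  exact: smoothv_row_mx (np_X h) (np_N h).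
move=> p c ca cp; apply: row_free_ker => v.
rewrite jac_row_mx mul_mx_row -row_mx0 => /eq_row_mx[X0 N0].
suff /eqP : v *m jac c Z p = 0 by rewrite mulmx_free_eq0 ?Zi// => /eqP.
have XE : jac c X p = 2^-1 *: (rho p *: jac c Z p + phi p *: jac c N p).
  by apply/matrixP => i k; rewrite jac_row (np_dX h)// !mxE.
have : v *m jac c X p = (2^-1 * rho p) *: (v *m jac c Z p).
  by rewrite XE -scalemxAr mulmxDr -!scalemxAr N0 scaler0 addr0 scalerA.
rewrite X0 => /esym/eqP; rewrite scaler_eq0 => /orP[|/eqP//].
by rewrite mulf_eq0 (negbTE (np_rho0 h p)) orbF invr_eq0 pnatr_eq0.
Qed.

End Dual.

End Surface.

(** * The flat front *)

Section Event.
Variables (R : realType) (S : surface R).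
Implicit Types (c : chart R S).

Definition event (a : R) (w : 'rV[R]_3) : 'rV[R]_(1 + 3) := row_mx a%:M w.

Lemma smoothv_event (f : S -> R) (F : S -> 'rV[R]_3) : smooth f -> smoothv F ->
  smoothv (fun p => event (f p) (F p)).
Proof.
move=> sf sF; apply: smoothv_row_mx => // k.
by move: sf; congr (smooth _); apply/funext => p; rewrite mxE (ord1 k) eqxx mulr1n.
Qed.

Lemma vd_event c i (f : S -> R) (F : S -> 'rV[R]_3) p :
  vd c i (fun q => event (f q) (F q)) p = event (pd c i f p) (vd c i F p).
Proof.
rewrite /vd /event jac_row_mx row_row_mx; congr row_mx.
apply/rowP => k; rewrite (ord1 k) !mxE eqxx mulr1n; congr (pd _ _ _ _).
by apply/funext => q; rewrite mxE eqxx mulr1n.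
Qed.

Lemma scale_event a b (w : 'rV[R]_3) : a *: event b w = event (a * b) (a *: w).
Proof. by rewrite /event scale_row_mx scale_scalar_mx. Qed.

Lemma add_event a b (v w : 'rV[R]_3) : event a v + event b w = event (a + b) (v + w).
Proof. by rewrite /event add_row_mx raddfD. Qed.

End Event.

(* A trace-free symmetric 2x2 matrix has a scalar square. *)
Lemma trace_free_third_form (R : realType) (J : 'M[R]_(2, 3))
    (z w : 'I_2 -> 'rV[R]_3) (n : 'rV[R]_3) :
  let E i j := sprod 1%:M (z i) (z j) in
  let L i j := sprod 1%:M (w i) (z j) in
  row_free J -> (forall i, row i J = z i) -> sprod 1%:M n n = 1 ->
  (forall i, sprod 1%:M (z i) n = 0) -> (forall i, sprod 1%:M (w i) n = 0) ->
  L 1 0 = L 0 1 -> E 1 1 * L 0 0 - 2 * E 0 1 * L 0 1 + E 0 0 * L 1 1 = 0 ->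
  forall i j, (E 0 0 * E 1 1 - E 0 1 ^+ 2) * sprod 1%:M (w i) (w j) =
    - (L 0 0 * L 1 1 - L 0 1 ^+ 2) * E i j.
Proof.
move=> E L Jf Jz nn zn wn LC tr i j.
have EC : E 1 0 = E 0 1 by exact: dotnC.
(* Cramer's rule for the coordinates of w_k in the basis z_0, z_1 of the tangent plane, with the
   determinant cleared. *)
have wE k : (E 0 0 * E 1 1 - E 0 1 ^+ 2) *: w k =
    (E 1 1 * L k 0 - E 0 1 * L k 1) *: z 0
    + (E 0 0 * L k 1 - E 0 1 * L k 0) *: z 1.
  apply/eqP; rewrite -subr_eq0; apply/eqP.
  apply: (euclidean_frame Jf nn) => [l||l]; first by rewrite Jz.
    by rewrite sprodBl sprodDl !sprodZl !zn wn; ring.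
  rewrite Jz sprodBl sprodDl !sprodZl.
  rewrite -/(E 0 l) -/(E 1 l) -/(L k l).
  by case: (ord2P l) => ->; rewrite ?EC; ring.
rewrite -sprodZl wE sprodDl !sprodZl !(dotnC (z _) (w j)) -/(L j 0) -/(L j 1).
move: LC EC tr; move: (E) (L) => e l {E L wE} lC eC tr.
(* The trace condition in the form in which it is substituted below. *)
have e1 : e 1 1 * l 0 0 = 2 * e 0 1 * l 0 1 - e 0 0 * l 1 1.
  by apply/eqP; rewrite -subr_eq0 -tr; apply/eqP; ring.
case: (ord2P i) => ->; case: (ord2P j) => ->; rewrite ?lC ?eC.
- rewrite mulrBl e1; ring.
- rewrite mulrBl e1; ring.
- rewrite [X in _ + X]mulrBl mulrBl.
  rewrite [e 1 1 * _ * _]mulrAC e1; ring.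
- rewrite [X in _ + X]mulrBl.
  have -> : e 0 0 * l 1 1 = 2 * e 0 1 * l 0 1 - e 1 1 * l 0 0 by rewrite e1; ring.
  ring.
Qed.

Section SecondForm.
Variables (R : realType) (S : surface R) (c : chart R S) (p : S).
Variables (Z N : S -> 'rV[R]_3).
Hypotheses (ca : atlas c) (cp : cdom c p) (sZ : smoothv Z) (sN : smoothv N).
Hypothesis (Zi : immersed_at Z p).
Hypothesis (NN : forall q, sprod 1%:M (N q) (N q) = 1).
Hypothesis ZN : forall k q, cdom c q -> sprod 1%:M (vd c k Z q) (N q) = 0.
Hypothesis min : minimal Z N.

Notation "<< u , v >>" := (sprod 1%:M u v).
Notation E i j := << vd c i Z p, vd c j Z p >>.
Notation L i j := << vd c i N p, vd c j Z p >>.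

Let LC : L 1 0 = L 0 1.
Proof. exact: (shape_symmetric 1 0 ca cp sZ sN ZN).2. Qed.

Let EC : E 1 0 = E 0 1. Proof. exact: dotnC. Qed.

Lemma formI_det_neq0 : E 0 0 * E 1 1 - E 0 1 ^+ 2 != 0.
Proof.
have := gram_unit (Zi ca cp); rewrite unitmxE unitfE det2.
by rewrite -/(first_form 1%:M c Z p) !first_formE EC expr2.
Qed.

(** tr(I^-1 II) = 0 with the inverse written through the adjugate and the determinant cleared. *)
Lemma minimal_trace : E 1 1 * L 0 0 - 2 * E 0 1 * L 0 1 + E 0 0 * L 1 1 = 0.
Proof.
have Iu : formI c Z p \in unitmx := gram_unit (Zi ca cp).
have [e eE] : exists e, forall i j, E i j = e i j by exists (fun i j => E i j).
have [l lE] : exists l, forall i j, L i j = l i j by exists (fun i j => L i j).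
have IE i j : formI c Z p i j = e i j by rewrite -eE -first_formE.
have IIE i j : formII c Z N p i j = - l j i by rewrite formIIE -lE dotnC.
have lC : l 1 0 = l 0 1 by rewrite -!lE.
have eC : e 1 0 = e 0 1 by rewrite -!eE.
have D0 := formI_det_neq0; rewrite !eE in D0.
rewrite !eE !lE; have := min ca cp.
rewrite /invmx Iu -scalemxAl linearZ /= det2 !IE eC -expr2.
move/eqP; rewrite mulf_eq0 invr_eq0 pnatr_eq0 /= mulf_eq0 invr_eq0 (negbTE D0) /=.
have [A00 A01 A10 A11] := adj2 (formI c Z p).
rewrite /mxtrace sum2 [X in X + _]mxE [X in _ + X]mxE !sum2.
rewrite A00 A01 A10 A11 !IE !IIE lC eC => /eqP T.
by apply/eqP; rewrite -oppr_eq0 -T; apply/eqP; ring.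
Qed.

(** This is III - 2 H II + K I = 0 for H = 0, multiplied by det I. *)
Lemma minimal_third_form i j :
  (E 0 0 * E 1 1 - E 0 1 ^+ 2) * << vd c i N p, vd c j N p >> =
  - (L 0 0 * L 1 1 - L 0 1 ^+ 2) * E i j.
Proof.
apply: (@trace_free_third_form _ (jac c Z p) (fun i => vd c i Z p)
  (fun i => vd c i N p) (N p) (Zi ca cp) _ (NN p) (fun i => ZN i cp)
  (fun i => pd_unit i ca cp sN NN) LC minimal_trace) => //.
Qed.

End SecondForm.

(** * The family of parallel fronts *)

Section Lightcone.
Variables (R : realType) (S : surface R).
Variables (Z N X : S -> 'rV[R]_3) (rho phi : S -> R).
Hypothesis h : normalized_pair Z N X rho phi.
Hypothesis Zi : forall p, immersed_at Z p.
Hypothesis min : minimal Z N.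

Notation "<< u , v >>" := (sprod (Defs.minkowski R) u v).

(* The two null vectors X + Nu = (r + s)(1, N), X - Nu = (r - s)(1, N~) *)
Definition null_p p := event (- (rho p)^-1) (- (rho p)^-1 *: N p).
Definition null_m p := event (- phi p) (2 *: X p - phi p *: N p).

(** One family for all purposes: the coefficients (1, 1) give the front, (1, -1) its normal, (e^t,
    e^-t) the parallel front at distance t. Since the null vectors have product -2, the square of
    [hfront a b] is - a b, and [hfront a (- b)] is orthogonal to it. *)
Definition hfront a b p := (a / 2) *: null_p p + (b / 2) *: null_m p.

Let s_inv_rho : smooth (fun p => - (rho p)^-1).
Proof.
move=> c ca; apply: (chart_smoothN ca).
exact: smooth_inv (np_rho0 h) (np_rho h) c ca.
Qed.

Lemma smooth_null_p : smoothv null_p.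
Proof.
apply: smoothv_event => // k c ca.
apply: (chart_smoothvZ ca (s_inv_rho ca)) => l; exact: (np_N h).
Qed.

Lemma smooth_null_m : smoothv null_m.
Proof.
apply: smoothv_event => [c ca|].
  exact: (chart_smoothN ca (np_phi h ca)).
apply: smoothvB_scaled (np_phi h) _ (np_N h) => k c ca.
have sXc : chart_smoothv c X by move=> l; apply: (np_X h).
exact: (chart_smoothvZ ca (chart_smooth_cst (c := c) 2) sXc).
Qed.

Lemma vd_null_p c i p : atlas c -> cdom c p -> vd c i null_p p =
  event (pd c i rho p / rho p ^+ 2)
    ((pd c i rho p / rho p ^+ 2) *: N p - (rho p)^-1 *: vd c i N p).
Proof.
move=> ca cp; rewrite vd_event.
have sNc : chart_smoothv c N by move=> k; apply: (np_N h).
have dr : pd c i (fun q => - (rho q)^-1) p = pd c i rho p / rho p ^+ 2.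
  rewrite pdN//; last exact: chart_smooth_diff (smooth_inv (np_rho0 h) (np_rho h) ca) cp.
  rewrite (pd_inv i ca cp (np_rho h) (np_rho0 h p)) opprK expr2 invfM; ring.
by rewrite (vdZ ca i (s_inv_rho ca) sNc cp) dr scaleNr.
Qed.

(* The equation for dX makes the coefficient of dN vanish. *)
Lemma vd_null_m c i p : atlas c -> cdom c p -> vd c i null_m p =
  event (- pd c i phi p) (rho p *: vd c i Z p - pd c i phi p *: N p).
Proof.
move=> ca cp; rewrite vd_event.
have sNc : chart_smoothv c N by move=> k; apply: (np_N h).
have sXc : chart_smoothv c X by move=> k; apply: (np_X h).
have sfc := np_phi h ca.
have s2c := chart_smooth_cst (c := c) 2.
rewrite pdN//; last exact: chart_smooth_diff sfc cp.
rewrite (vdD ca i (chart_smoothvZ ca s2c sXc) (chart_smoothvN ca (chart_smoothvZ ca sfc sNc)) cp).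
rewrite (vdZ ca i s2c sXc cp) pd_cst scale0r add0r.
rewrite (vdN ca i (chart_smoothvZ ca sfc sNc) cp) (vdZ ca i sfc sNc cp).
by rewrite (np_dX h)//; congr event; apply/rowP => k; rewrite !mxE; field.
Qed.

Lemma null_pp p : << null_p p, null_p p >> = 0.
Proof.
by rewrite minkowski_dot /dot !sprodZl !sprodZr (np_NN h); ring.
Qed.

Lemma null_mm p : << null_m p, null_m p >> = 0.
Proof.
rewrite minkowski_dot /dot !sprodBl !sprodBr !sprodZl !sprodZr (np_NN h).
rewrite (dotnC (N p)) (np_XN h) (np_XX h); ring.
Qed.

Lemma null_pm p : << null_p p, null_m p >> = - 2.
Proof.
rewrite minkowski_dot /dot !sprodBr !sprodZl !sprodZr (np_NN h).
by rewrite (dotnC (N p)) (np_XN h); field; exact: np_rho0 h p.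
Qed.

Section AtPoint.
Variables (c : chart R S) (p : S).
Hypotheses (ca : atlas c) (cp : cdom c p).

Let NdN i : sprod 1%:M (N p) (vd c i N p) = 0.
Proof. by rewrite dotnC (pd_unit i ca cp (np_N h) (np_NN h)). Qed.

Let NdZ i : sprod 1%:M (N p) (vd c i Z p) = 0.
Proof. by rewrite dotnC (np_ZN h). Qed.

Let dNN i : sprod 1%:M (vd c i N p) (N p) = 0.
Proof. by rewrite dotnC NdN. Qed.

Lemma dnull_p_m i : << vd c i null_p p, null_m p >> = 0.
Proof.
rewrite vd_null_p// minkowski_dot /dot !sprodBl !sprodBr !sprodZl !sprodZr.
rewrite (np_NN h) dNN !(dotnC _ (X p)) (np_XN h) (np_drho h)//.
by field; exact: np_rho0 h p.
Qed.

Lemma dnull_p_p i : << vd c i null_p p, null_p p >> = 0.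
Proof.
rewrite vd_null_p// minkowski_dot /dot !sprodBl !sprodZl !sprodZr (np_NN h) dNN.
by ring.
Qed.

Lemma dnull_m_p i : << vd c i null_m p, null_p p >> = 0.
Proof.
rewrite vd_null_m// minkowski_dot /dot !sprodBl !sprodZl !sprodZr (np_NN h).
by rewrite (np_ZN h)//; ring.
Qed.

Lemma dnull_m_m i : << vd c i null_m p, null_m p >> = 0.
Proof.
rewrite vd_null_m// minkowski_dot /dot !sprodBl !sprodBr !sprodZl !sprodZr.
rewrite (np_NN h) !(dotnC _ (X p)) (np_XN h) (np_dphi h)// (dotnC _ (N p)) NdZ.
by ring.
Qed.

Lemma dnull_pp i j : << vd c i null_p p, vd c j null_p p >> =
  (rho p)^-1 ^+ 2 * sprod 1%:M (vd c i N p) (vd c j N p).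
Proof.
rewrite !vd_null_p// minkowski_dot /dot !sprodBl !sprodBr !sprodZl !sprodZr.
by rewrite (np_NN h) dNN NdN; ring.
Qed.

Lemma dnull_mm i j : << vd c i null_m p, vd c j null_m p >> =
  rho p ^+ 2 * sprod 1%:M (vd c i Z p) (vd c j Z p).
Proof.
rewrite !vd_null_m// minkowski_dot /dot !sprodBl !sprodBr !sprodZl !sprodZr.
by rewrite (np_NN h) NdZ (np_ZN h)//; ring.
Qed.

Lemma dnull_pm i j : << vd c i null_p p, vd c j null_m p >> =
  - sprod 1%:M (vd c i N p) (vd c j Z p).
Proof.
rewrite vd_null_p// vd_null_m// minkowski_dot /dot.
rewrite !sprodBl !sprodBr !sprodZl !sprodZr.
by rewrite (np_NN h) NdZ dNN; field; exact: np_rho0 h p.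
Qed.

Lemma vd_hfront a b i :
  vd c i (hfront a b) p = (a / 2) *: vd c i null_p p + (b / 2) *: vd c i null_m p.
Proof.
have sA : chart_smoothv c null_p by move=> k; apply: smooth_null_p.
have sB : chart_smoothv c null_m by move=> k; apply: smooth_null_m.
rewrite (vdD ca i (chart_smoothvZ ca (chart_smooth_cst _) sA)
  (chart_smoothvZ ca (chart_smooth_cst _) sB) cp).
rewrite (vdZ ca i (chart_smooth_cst _) sA cp).
by rewrite (vdZ ca i (chart_smooth_cst _) sB cp) !pd_cst !scale0r !add0r.
Qed.

End AtPoint.

Lemma smooth_hfront a b : smoothv (hfront a b).
Proof.
move=> k c ca.
have sA : chart_smoothv c null_p by move=> l; apply: smooth_null_p.
have sB : chart_smoothv c null_m by move=> l; apply: smooth_null_m.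
by apply: (chart_smoothvD ca); apply: (chart_smoothvZ ca) => //;
  exact: chart_smooth_cst.
Qed.

Lemma hfront_dot a b a' b' p :
  << hfront a b p, hfront a' b' p >> = - (a * b' + b * a') / 2.
Proof.
rewrite /hfront !sprodDl !sprodDr !sprodZl !sprodZr null_pp null_mm.
by rewrite (sprodC (null_m p) _ (tr_minkowski R)) null_pm; field.
Qed.

(** The derivatives of both null vectors are orthogonal to both null vectors, so the whole family
    shares its normal planes. *)
Lemma hfront_normal c i a b a' b' p : atlas c -> cdom c p ->
  << vd c i (hfront a b) p, hfront a' b' p >> = 0.
Proof.
move=> ca cp; rewrite vd_hfront//.
have := dnull_m_p ca cp i; have := dnull_p_p ca cp i.
have := dnull_m_m ca cp i; have := dnull_p_m ca cp i; rewrite /hfront.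
move: (vd c i null_p p) (vd c i null_m p) => A B.
move: (null_p p) (null_m p) => u v Av Bv Au Bu.
by rewrite sprodDl !sprodDr !sprodZl !sprodZr Av Bv Au Bu; ring.
Qed.

(** With P = - a^2 K / (rho^2 D) and Q = b^2 rho^2, the induced metric is (P + Q)/4 E - (ab/2) L,
    and the form [h] is (P - Q)/4 E. Since L is trace-free, the determinants differ by - P Q D / 4 -
    (ab)^2 K / 4, which vanishes because P Q = - (ab)^2 K / D. *)
Lemma hfront_flat c a b p : atlas c -> cdom c p -> a * b = 1 ->
  gauss_curvature c (first_form (Defs.minkowski R) c (hfront a b)) p = 0.
Proof.
move=> ca cp ab.
have sX a' b' : chart_smoothv c (hfront a' b') by move=> l; apply: smooth_hfront.
apply: (hyperbolic_flat (Nu := hfront a (- b)) ca (sX _ _) (sX _ _)) => //.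
- by move=> q _; rewrite hfront_dot; transitivity (- (a * b)); [field|rewrite ab].
- by move=> q _; rewrite hfront_dot; transitivity (a * b); [field|].
- by move=> q _; rewrite hfront_dot; field.
- by move=> i q cq; exact: hfront_normal.
have ZN k q : cdom c q -> sprod 1%:M (vd c k Z q) (N q) = 0.
  by move=> cq; exact: (np_ZN h).
have III := minimal_third_form ca cp (np_Z h) (np_N h) (Zi (p := p)) (np_NN h) ZN min.
have D0 := formI_det_neq0 ca cp (Zi (p := p)).
have tr := minimal_trace ca cp (np_Z h) (np_N h) (Zi (p := p)) ZN min.
have LC := (shape_symmetric 1 0 ca cp (np_Z h) (np_N h) ZN).2.
have [e eE] : exists e, forall i j, sprod 1%:M (vd c i Z p) (vd c j Z p) = e i j.
  by exists (fun i j => sprod 1%:M (vd c i Z p) (vd c j Z p)).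
have [l lE] : exists l, forall i j, sprod 1%:M (vd c i N p) (vd c j Z p) = l i j.
  by exists (fun i j => sprod 1%:M (vd c i N p) (vd c j Z p)).
have eC : e 1 0 = e 0 1 by rewrite -!eE dotnC.
rewrite !lE in LC tr III; rewrite !eE in tr D0 III.
set D := _ - _ in III D0; set K := _ - _ in III.
(* K / D is the Gauss curvature of [Z]. *)
have {}III i j : sprod 1%:M (vd c i N p) (vd c j N p) = - (K / D) * e i j.
  by apply: (mulfI D0); rewrite III eE; field; exact: D0.
have G a' b' i j : << vd c i (hfront a b) p, vd c j (hfront a' b') p >> =
    (- (a * a' * (rho p)^-1 ^+ 2 * (K / D)) + b * b' * rho p ^+ 2) / 4 * e i j
    - (a * b' * l i j + b * a' * l j i) / 4.
  rewrite (vd_hfront ca cp a b i) (vd_hfront ca cp a' b' j).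
  have := dnull_pm ca cp j i; rewrite (sprodC _ _ (tr_minkowski R)).
  have := dnull_pm ca cp i j; have := dnull_pp ca cp i j.
  have := dnull_mm ca cp i j; rewrite III eE !lE.
  move: (vd c i null_p p) (vd c j null_p p) => A A'.
  move: (vd c i null_m p) (vd c j null_m p) => B B' mm pp pm mp.
  rewrite sprodDl !sprodDr !sprodZl !sprodZr mm pp pm mp.
  by field; rewrite D0 (np_rho0 h p).
rewrite det2 !first_formE !G LC eC.
have r0 := np_rho0 h p.
apply/eqP; rewrite -subr_eq0; apply/eqP.
(* The mixed term of det(first form) is a multiple of the trace; this is its factor. *)
rewrite -[RHS](mulr0 (2 * (a * b) *
  (- (a ^+ 2 * (rho p)^-1 ^+ 2 * (K / D)) + b ^+ 2 * rho p ^+ 2) / 16)) -tr.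
by move: D0; rewrite /K /D => D0; field; rewrite D0 r0.
Qed.

Lemma flat_hfront : flat_front (hfront 1 1) (hfront 1 (-1)).
Proof.
split; last first.
  move=> t c p ca cp _.
  (* cosh t + sinh t = e^t and cosh t - sinh t = e^-t are the factors of the two null vectors. *)
  have -> : parallel t (hfront 1 1) (hfront 1 (-1)) = hfront (expR t) (expR (- t)).
    apply/funext => q; rewrite /parallel /hfront.
    move: (null_p q) (null_m q) => A B.
    by apply/rowP => k; rewrite !mxE; field.
  by apply: hfront_flat => //; exact: expRxMexpNx_1.
split; [by move=> p; rewrite hfront_dot; field
       |by move=> p; rewrite hfront_dot; field|split].
  split; [exact: smooth_hfront|exact: smooth_hfront
         |by move=> p; rewrite hfront_dot; field|].
  by move=> c p ca cp; apply/jac_tangent => i; exact: hfront_normal.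
split; first by apply: smoothv_row_mx; exact: smooth_hfront.
move=> p c ca cp; apply: row_free_ker => v.
rewrite jac_row_mx mul_mx_row -row_mx0 => /eq_row_mx[X0 N0].
(* A direction that kills dX and dNu kills the derivative of X - Nu. The time part of the latter
   gives dphi = 0, and then the space part is rho dZ. *)
have dB : jac c null_m p = jac c (hfront 1 1) p - jac c (hfront 1 (-1)) p.
  apply/matrixP => i k; rewrite [RHS]mxE [X in _ = _ + X]mxE !jac_row !vd_hfront//.
  move: (vd c i null_p p) (vd c i null_m p) => A B.
  by rewrite !mxE; field.
have := congr1 (mulmx v) dB; rewrite mulmxBr X0 N0 subr0.
have -> : jac c null_m p = row_mx (- (dform c phi p)^T)
    (rho p *: jac c Z p - (dform c phi p)^T *m N p).
  apply/row_matrixP => i; rewrite -/(vd c i null_m p) vd_null_m//.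
  rewrite row_row_mx /event; congr row_mx.
    by apply/rowP => k; rewrite (ord1 k) !mxE eqxx mulr1n.
  by apply/rowP => k; rewrite !mxE big_ord1 !mxE.
rewrite mul_mx_row -row_mx0 => /eq_row_mx[df0 dZ0].
have {}df0 : v *m (dform c phi p)^T = 0.
  by apply/eqP; rewrite -oppr_eq0 -mulmxN df0.
move: dZ0; rewrite mulmxBr mulmxA df0 mul0mx subr0 -scalemxAr => /eqP.
rewrite scaler_eq0 (negbTE (np_rho0 h p)) /= mulmx_free_eq0 ?Zi//.
by move/eqP.
Qed.

Lemma time_part_event a (w : 'rV[R]_3) : time_part (event a w) = a.
Proof. by rewrite /time_part /event row_mxKl mxE eqxx mulr1n. Qed.

Lemma space_part_event a (w : 'rV[R]_3) : space_part (event a w) = w.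
Proof. by rewrite /space_part /event row_mxKr. Qed.

Lemma hfront_event a b p : hfront a b p =
  event (- (a / rho p + b * phi p) / 2)
    (- ((a / rho p + b * phi p) / 2) *: N p + b *: X p).
Proof.
rewrite /hfront !scale_event add_event; congr event; first by field; exact: np_rho0 h p.
by apply/rowP => k; rewrite !mxE; field; exact: np_rho0 h p.
Qed.

Lemma lightlike_normal_p : lightlike_normal 1 (hfront 1 1) (hfront 1 (-1)) = N.
Proof.
apply/funext => p; rewrite /lightlike_normal !hfront_event.
rewrite !time_part_event !space_part_event.
have r0 := np_rho0 h p.
have -> : - (1 / rho p + 1 * phi p) / 2 + 1 * (- (1 / rho p + -1 * phi p) / 2)
    = - (rho p)^-1 by field.
by apply/rowP => k; rewrite !mxE; field.
Qed.

Lemma lightlike_normal_m :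
  lightlike_normal (-1) (hfront 1 1) (hfront 1 (-1)) = dualN N X phi.
Proof.
apply/funext => p; rewrite /lightlike_normal !hfront_event.
rewrite !time_part_event !space_part_event.
have r0 := np_rho0 h p; have f0 := np_phi0 h p.
have -> : - (1 / rho p + 1 * phi p) / 2 + -1 * (- (1 / rho p + -1 * phi p) / 2)
    = - phi p by field.
by apply/rowP => k; rewrite !mxE; field; rewrite r0 f0.
Qed.

Lemma associated_frontal_p :
  associated_frontal 1 (hfront 1 1) (hfront 1 (-1)) = X.
Proof.
apply/funext => p; rewrite /associated_frontal !hfront_event.
rewrite !time_part_event !space_part_event.
have r0 := np_rho0 h p.
have -> : - (1 / rho p + 1 * phi p) / 2 + 1 * (- (1 / rho p + -1 * phi p) / 2)
    = - (rho p)^-1 by field.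
by apply/rowP => k; rewrite !mxE; field.
Qed.

Lemma associated_frontal_m :
  associated_frontal (-1) (hfront 1 1) (hfront 1 (-1)) = dualX X rho phi.
Proof.
apply/funext => p; rewrite /associated_frontal !hfront_event.
rewrite !time_part_event !space_part_event.
have r0 := np_rho0 h p; have f0 := np_phi0 h p.
have -> : - (1 / rho p + 1 * phi p) / 2 + -1 * (- (1 / rho p + -1 * phi p) / 2)
    = - phi p by field.
by apply/rowP => k; rewrite !mxE; field; rewrite r0 f0.
Qed.

End Lightcone.

(** * Stereographic projection *)

Section Stereo.
Local Open Scope complex_scope.
Variable R : realType.
Implicit Types (u v w n m x : 'rV[R]_3).

Lemma ord3P (k : 'I_3) : [\/ k = 0, k = 1 | k = 2].
Proof.
by case: k => [[|[|[|//]]] ?]; [constructor 1|constructor 2|constructor 3];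
  apply: val_inj.
Qed.

Lemma dot3E u v :
  sprod 1%:M u v = u 0 0 * v 0 0 + u 0 1 * v 0 1 + u 0 2 * v 0 2.
Proof.
rewrite dotnE !big_ord_recl big_ord0 addr0 addrA.
by congr (_ + _ * _ + _ * _); congr (_ 0 _); apply: val_inj.
Qed.

Lemma half_complex : (2^-1 : R[i]) = 2^-1 +i* 0.
Proof.
have two0 : (2 : R[i]) != 0 by rewrite pnatr_eq0.
apply: (mulfI two0).
rewrite mulfV ?pnatr_eq0//; apply/eqP; rewrite eq_complex /=.
by apply/andP; split; apply/eqP; field.
Qed.

(** The last two hypotheses are the real and imaginary parts of 4 z = o d^2. *)
Lemma complex_quotient (z1 z2 d1 d2 o1 o2 : R) (d : R[i]) :
  d = d1 +i* d2 -> d1 ^+ 2 + d2 ^+ 2 != 0 ->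
  4 * z1 = o1 * (d1 ^+ 2 - d2 ^+ 2) - 2 * o2 * d1 * d2 ->
  4 * z2 = o2 * (d1 ^+ 2 - d2 ^+ 2) + 2 * o1 * d1 * d2 ->
  4 * (z1 +i* z2) / d ^+ 2 = o1 +i* o2.
Proof.
move=> -> d0 E1 E2.
have dn0 : (d1 +i* d2) ^+ 2 != 0.
  rewrite sqrf_eq0 eq_complex /=; apply/negP => /andP[/eqP d10 /eqP d20].
  by move: d0; rewrite d10 d20 expr0n addr0 eqxx.
apply: (mulIf dn0); rewrite divfK//.
apply/eqP; rewrite eq_complex /= !(mulr0, mul0r, addr0, add0r, subr0).
apply/andP; split; apply/eqP.
  by transitivity (4 * z1); [ring|rewrite E1; ring].
by transitivity (4 * z2); [ring|rewrite E2; ring].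
Qed.

(** Valid at the pole as well, where [fin None] and the two quotients by 0 are all 0. *)
Lemma fin_stereo x :
  fin (stereo x) = (x 0 0 / (1 - x 0 2)) +i* (x 0 1 / (1 - x 0 2)).
Proof.
by rewrite /stereo; case: eqP => //= ->; rewrite subrr invr0 !mulr0.
Qed.

(* 1 / stereo x = (x_1 - i x_2) / (1 + x_3) on the sphere; both sides are 0 at
   the two poles. *)
Lemma fin_sphere_inv_stereo x : sprod 1%:M x x = 1 ->
  fin (sphere_inv (stereo x)) =
    (x 0 0 / (1 + x 0 2)) +i* (- (x 0 1 / (1 + x 0 2))).
Proof.
rewrite dot3E => x1; rewrite /stereo; case: (eqVneq (x 0 2) 1) => [x2|x2] /=.
  have : x 0 0 ^+ 2 + x 0 1 ^+ 2 = 0 by rewrite x2 in x1; lra.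
  move/eqP; rewrite paddr_eq0 ?sqr_ge0// !sqrf_eq0 => /andP[/eqP-> /eqP->].
  by rewrite !mul0r oppr0.
have b0 : 1 - x 0 2 != 0 by rewrite subr_eq0 eq_sym.
have q : x 0 0 ^+ 2 + x 0 1 ^+ 2 = (1 - x 0 2) * (1 + x 0 2) by lra.
have [/eqP|z0] := eqVneq; rewrite ?eq_complex /=.
  rewrite !mulf_eq0 !invr_eq0 (negbTE b0) !orbF => /andP[/eqP-> /eqP->].
  by rewrite !mul0r oppr0.
have c0 : 1 + x 0 2 != 0.
  apply/eqP => c0; move: q; rewrite c0 mulr0 => /eqP.
  rewrite paddr_eq0 ?sqr_ge0// !sqrf_eq0 => /andP[/eqP p0 /eqP p1].
  by move: z0; rewrite p0 p1 !mul0r eqxx.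
apply: (mulfI z0); rewrite mulfV//; apply/eqP; rewrite eq_complex /=.
apply/andP; split; apply/eqP; last by field; rewrite b0 c0.
transitivity ((x 0 0 ^+ 2 + x 0 1 ^+ 2) / ((1 - x 0 2) * (1 + x 0 2))).
  by rewrite q divff// mulf_neq0.
by field; rewrite b0 c0.
Qed.

(* The coefficient omega of the isotropic vector W(g) omega whose real part is
   w, where g = stereo n and w is orthogonal to n. *)
Definition weierstrass_coef n w : R[i] :=
  ((1 - n 0 2) * w 0 0 + w 0 2 * n 0 0) +i*
  (- ((1 - n 0 2) * w 0 1 + w 0 2 * n 0 1)).

Section NonPole.
Variables (n w : 'rV[R]_3).
Hypotheses (nn : sprod 1%:M n n = 1) (wn : sprod 1%:M w n = 0).
Hypothesis n2 : n 0 2 != 1.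

Let b := 1 - n 0 2.
Let s := n 0 0 / b.
Let t := n 0 1 / b.
Let o1 := b * w 0 0 + w 0 2 * n 0 0.
Let o2 := - (b * w 0 1 + w 0 2 * n 0 1).

Let b0 : b != 0. Proof. by rewrite subr_eq0 eq_sym. Qed.

(** The inverse of stereographic projection; [b] is kept as a variable bound by one polynomial
    relation. *)
Lemma stereo_coords : [/\ n 0 0 = s * b, n 0 1 = t * b, n 0 2 = 1 - b &
  b * (1 + s ^+ 2 + t ^+ 2) = 2].
Proof.
split; rewrite /s /t; try by field.
  by rewrite /b; ring.
have q : n 0 0 ^+ 2 + n 0 1 ^+ 2 = b * (2 - b).
  by move: nn; rewrite dot3E /b; lra.
transitivity (b + (n 0 0 ^+ 2 + n 0 1 ^+ 2) / b); first by field.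
by rewrite q; field.
Qed.

(** The real form of w = Re(W(s + i t)(o1 + i o2)). The definitions of o1 and o2 together with <w,
    n> = 0 are three linear equations for w, which are solved here. *)
Lemma weierstrass_coords :
  [/\ w 0 0 = 2^-1 * ((1 - s ^+ 2 + t ^+ 2) * o1 + 2 * s * t * o2),
      w 0 1 = - 2^-1 * ((1 + s ^+ 2 - t ^+ 2) * o2 + 2 * s * t * o1) &
      w 0 2 = s * o1 - t * o2].
Proof.
have [n0E n1E n2E bE] := stereo_coords.
have o1E : o1 = b * (w 0 0 + w 0 2 * s) by rewrite /o1 n0E; ring.
have o2E : o2 = - b * (w 0 1 + w 0 2 * t) by rewrite /o2 n1E; ring.
have w2E : w 0 2 * (1 - b) = - b * (s * w 0 0 + t * w 0 1).
  by move: wn; rewrite dot3E n0E n1E n2E; lra.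
have bE' : b * s ^+ 2 + b * t ^+ 2 = 2 - b by rewrite -bE; ring.
split; rewrite o1E o2E.
- transitivity (2^-1 * (b * (1 + s ^+ 2 + t ^+ 2) * w 0 0
    - s * (2 * (b * s * w 0 0 + b * t * w 0 1) - w 0 2 * b * (1 - (s ^+ 2 + t ^+ 2))))); last by ring.
  have -> : 2 * (b * s * w 0 0 + b * t * w 0 1) = - 2 * (w 0 2 * (1 - b)) by rewrite w2E; ring.
  have -> : w 0 2 * b * (1 - (s ^+ 2 + t ^+ 2)) = w 0 2 * (b - (b * s ^+ 2 + b * t ^+ 2)) by ring.
  by rewrite bE bE'; field.
- transitivity (2^-1 * (b * (1 + s ^+ 2 + t ^+ 2) * w 0 1
    - t * (2 * (b * s * w 0 0 + b * t * w 0 1) - w 0 2 * b * (1 - (s ^+ 2 + t ^+ 2))))); last by ring.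
  have -> : 2 * (b * s * w 0 0 + b * t * w 0 1) = - 2 * (w 0 2 * (1 - b)) by rewrite w2E; ring.
  have -> : w 0 2 * b * (1 - (s ^+ 2 + t ^+ 2)) = w 0 2 * (b - (b * s ^+ 2 + b * t ^+ 2)) by ring.
  by rewrite bE bE'; field.
- transitivity (b * (s * w 0 0 + t * w 0 1) + w 0 2 * (b * s ^+ 2 + b * t ^+ 2)); last by ring.
  have -> : b * (s * w 0 0 + t * w 0 1) = - (w 0 2 * (1 - b)) by rewrite w2E; ring.
  by rewrite bE'; ring.
Qed.

Lemma weierstrass_representation (k : 'I_3) :
  w 0 k = complex.Re (weierstrass_vector (fin (stereo n)) (weierstrass_coef n w) k).
Proof.
have [w0E w1E w2E] := weierstrass_coords.
rewrite fin_stereo /weierstrass_coef -/b -/s -/t -/o1 -/o2.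
case: (ord3P k) => ->; rewrite /weierstrass_vector /= ?half_complex.
- by rewrite [LHS]w0E /= expr2 /=; field.
- by rewrite [LHS]w1E /= expr2 /=; field.
- by rewrite [LHS]w2E /=; field.
Qed.

End NonPole.

End Stereo.

(* With n = stereo^-1(s + i t), w the real part of W(s + i t)(o1 + i o2), and x
   arbitrary: up to scaling, the image under the differential of stereo of the
   reflection of w along x. *)
Lemma reflection_identity (R : realType) (s t b o1 o2 x0 x1 x2 : R) :
  b * (1 + s ^+ 2 + t ^+ 2) = 2 ->
  let w0 := 2^-1 * ((1 - s ^+ 2 + t ^+ 2) * o1 + 2 * s * t * o2) in
  let w1 := - 2^-1 * ((1 + s ^+ 2 - t ^+ 2) * o2 + 2 * s * t * o1) in
  let w2 := s * o1 - t * o2 in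
  let q := x0 * w0 + x1 * w1 + x2 * w2 in
  let r := x0 * x0 + x1 * x1 + x2 * x2 in
  let rho := x0 * (s * b) + x1 * (t * b) + x2 * (1 - b) in
  let u := x0 + s * x2 in
  let v := x1 + t * x2 in
  (2 * q * x0 - r * w0) * b + s * b * (2 * q * x2 - r * w2)
    + 2 * rho * (x0 * w2 - w0 * x2) = o1 * (u ^+ 2 - v ^+ 2) - 2 * o2 * u * v /\
  (2 * q * x1 - r * w1) * b + t * b * (2 * q * x2 - r * w2)
    + 2 * rho * (x1 * w2 - w1 * x2) = o2 * (u ^+ 2 - v ^+ 2) + 2 * o1 * u * v.
Proof.
move=> bE; have D0 : 1 + s ^+ 2 + t ^+ 2 != 0.
  by apply/eqP => D0; move: bE; rewrite D0 mulr0 => /esym/eqP; rewrite pnatr_eq0.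
have -> : b = 2 / (1 + s ^+ 2 + t ^+ 2) by rewrite -bE mulfK.
by split; field.
Qed.

Section Reflection.
Local Open Scope complex_scope.
Variables (R : realType) (n w x : 'rV[R]_3) (rho phi : R).
Hypotheses (nn : sprod 1%:M n n = 1) (wn : sprod 1%:M w n = 0).
Hypotheses (xn : sprod 1%:M x n = rho) (xx : sprod 1%:M x x = rho * phi).
Hypotheses (rho0 : rho != 0) (phi0 : phi != 0).

Let m := n - (2 / phi) *: x.
Let w' := - (rho / phi) *: w + (2 * sprod 1%:M x w / phi ^+ 2) *: x.

(** With mu = 2 / phi, stereo m - stereo n is - mu (u + i v) / (1 - m_2), and four times the
    derivative of stereo along w' is (mu / (1 - m_2))^2 (o1 + i o2)(u + i v)^2; the quotient leaves
    o1 + i o2. *)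
Lemma stereo_reflection : n 0 2 != 1 -> m 0 2 != 1 ->
  4 * (((w' 0 0 * (1 - m 0 2) + m 0 0 * w' 0 2) / (1 - m 0 2) ^+ 2) +i*
       ((w' 0 1 * (1 - m 0 2) + m 0 1 * w' 0 2) / (1 - m 0 2) ^+ 2))
    / (fin (stereo m) - fin (stereo n)) ^+ 2 = weierstrass_coef n w.
Proof.
move=> n2 m2.
have B0 : 1 - m 0 2 != 0 by rewrite subr_eq0 eq_sym.
have b0 : 1 - n 0 2 != 0 by rewrite subr_eq0 eq_sym.
have [n0E n1E n2E bE] := stereo_coords nn n2.
have [w0E w1E w2E] := weierstrass_coords nn wn n2.
rewrite !fin_stereo /weierstrass_coef.
set b : R := 1 - n 0 2 in b0 n0E n1E n2E bE w0E w1E w2E *.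
set s := n 0 0 / b in n0E n1E n2E bE w0E w1E w2E *.
set t := n 0 1 / b in n0E n1E n2E bE w0E w1E w2E *.
set o1 : R := b * w 0 0 + _ in w0E w1E w2E *.
set o2 := - (b * w 0 1 + _) in w0E w1E w2E *.
have := reflection_identity o1 o2 (x 0 0) (x 0 1) (x 0 2) bE.
rewrite -w0E -w1E -w2E -n0E -n1E -n2E /= -(dot3E x w) -(dot3E x x) -(dot3E x n) xn xx => -[T0 T1].
pose mu := 2 / phi.
have mu0 : mu != 0 by rewrite mulf_neq0 ?invr_eq0 ?pnatr_eq0.
have muE : mu * (rho * phi) = 2 * rho by rewrite /mu; field.
have m0E : m 0 0 = s * b - mu * x 0 0 by rewrite !mxE n0E.
have m1E : m 0 1 = t * b - mu * x 0 1 by rewrite !mxE n1E.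
have BE : 1 - m 0 2 = b + mu * x 0 2 by rewrite !mxE n2E /mu; ring.
have w'E k : w' 0 k = mu ^+ 2 / 4 * (2 * sprod 1%:M x w * x 0 k - rho * phi * w 0 k).
  by rewrite !mxE /mu; field.
set q := sprod 1%:M x w in T0 T1 w'E.
set u := x 0 0 + s * x 0 2 in T0 T1.
set v := x 0 1 + t * x 0 2 in T0 T1.
(* If u = v = 0, then x is parallel to n - (0, 0, 1), so the reflection along x takes n to the pole,
   contrary to [m2]. *)
have uv0 : u ^+ 2 + v ^+ 2 != 0.
  apply/negP; rewrite paddr_eq0 ?sqr_ge0// !sqrf_eq0 => /andP[/eqP u0 /eqP v0].
  have x0E : x 0 0 = - s * x 0 2 by rewrite -[LHS]subr0 -u0 /u; ring.
  have x1E : x 0 1 = - t * x 0 2 by rewrite -[LHS]subr0 -v0 /v; ring.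
  have rhoE : rho = - x 0 2.
    rewrite -xn dot3E x0E x1E n0E n1E n2E.
    transitivity (x 0 2 * (1 - b * (1 + s ^+ 2 + t ^+ 2))); first by ring.
    by rewrite bE; ring.
  have xxE : b * (rho * phi) = 2 * x 0 2 ^+ 2.
    by rewrite -xx dot3E x0E x1E -bE; ring.
  have : (1 - m 0 2) * (rho * phi) = 0.
    rewrite BE mulrDl xxE [mu * _ * _]mulrAC muE rhoE; ring.
  move/eqP; rewrite !mulf_eq0 (negbTE rho0) (negbTE phi0) !orbF.
  by rewrite (negbTE B0).
rewrite !w'E m0E m1E BE; rewrite {}BE in B0.
rewrite {}n0E -muE in T0; rewrite {}n1E -muE in T1.
clear w0E w1E w2E n2E bE muE m0E m1E w'E.
have uE : u = x 0 0 + s * x 0 2 by [].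
have vE : v = x 0 1 + t * x 0 2 by [].
clearbody q u v mu s t o1 o2 b.
apply: (@complex_quotient _ _ _ (- mu * u / (b + mu * x 0 2))
  (- mu * v / (b + mu * x 0 2))).
- rewrite uE vE; apply/eqP; rewrite eq_complex /=; apply/andP; split; apply/eqP;
    by field.
- have -> : (- mu * u / (b + mu * x 0 2)) ^+ 2 + (- mu * v / (b + mu * x 0 2)) ^+ 2 =
     (mu / (b + mu * x 0 2)) ^+ 2 * (u ^+ 2 + v ^+ 2) by field.
  by rewrite mulf_neq0// sqrf_eq0 mulf_neq0 ?invr_eq0.
- transitivity ((mu / (b + mu * x 0 2)) ^+ 2 *
    (o1 * (u ^+ 2 - v ^+ 2) - 2 * o2 * u * v)); last by field.
  by rewrite -T0; field.
- transitivity ((mu / (b + mu * x 0 2)) ^+ 2 *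
    (o2 * (u ^+ 2 - v ^+ 2) + 2 * o1 * u * v)); last by field.
  by rewrite -T1; field.
Qed.

(* Here stereo m is the point at infinity. *)
Lemma stereo_reflection_pole : m 0 0 = 0 -> m 0 1 = 0 -> m 0 2 = 1 ->
  - 4 * ((w' 0 0 / 2) +i* (- (w' 0 1 / 2))) = weierstrass_coef n w.
Proof.
move=> m0 m1 m2.
pose mu := 2 / phi.
have mu0 : mu != 0 by rewrite mulf_neq0 ?invr_eq0 ?pnatr_eq0.
(* As m is the pole, mu x = n - (0, 0, 1), and both sides become expressions in n and w. *)
have x0E : mu * x 0 0 = n 0 0 by move: m0; rewrite !mxE -/mu; lra.
have x1E : mu * x 0 1 = n 0 1 by move: m1; rewrite !mxE -/mu; lra.
have x2E : mu * x 0 2 = n 0 2 - 1 by move: m2; rewrite !mxE -/mu; lra.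
have w'E k : w' 0 k = 2^-1 * (mu * sprod 1%:M x w) * (mu * x 0 k)
    - 4^-1 * (mu ^+ 2 * (rho * phi)) * w 0 k.
  by rewrite !mxE /mu; field.
have qE : mu * sprod 1%:M x w = - w 0 2.
  rewrite dot3E !mulrDr !mulrA x0E x1E x2E.
  by move: wn; rewrite dot3E; lra.
have rE : mu ^+ 2 * (rho * phi) = 2 * (1 - n 0 2).
  rewrite -xx dot3E.
  transitivity ((mu * x 0 0) ^+ 2 + (mu * x 0 1) ^+ 2 + (mu * x 0 2) ^+ 2); first by ring.
  by rewrite x0E x1E x2E; move: nn; rewrite dot3E; lra.
rewrite /weierstrass_coef !w'E qE rE x0E x1E.
by apply/eqP; rewrite eq_complex /= !(mulr0, mul0r, addr0, add0r, subr0, oppr0);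
  apply/andP; split; apply/eqP; field.
Qed.

End Reflection.

(** * Weierstrass data *)

Section Cross.
Variable R : realType.
Implicit Types u v w n : 'rV[R]_3.

Definition cross u v : 'rV[R]_3 := \row_k
  [:: u 0 1 * v 0 2 - u 0 2 * v 0 1; u 0 2 * v 0 0 - u 0 0 * v 0 2;
      u 0 0 * v 0 1 - u 0 1 * v 0 0]`_k.

Lemma crossE u v : [/\ cross u v 0 0 = u 0 1 * v 0 2 - u 0 2 * v 0 1,
  cross u v 0 1 = u 0 2 * v 0 0 - u 0 0 * v 0 2 &
  cross u v 0 2 = u 0 0 * v 0 1 - u 0 1 * v 0 0].
Proof. by rewrite !mxE. Qed.

Lemma dot_cross u v : sprod 1%:M (cross u v) u = 0.
Proof. by have [c0 c1 c2] := crossE u v; rewrite dot3E c0 c1 c2; ring. Qed.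

Lemma dot_crossC u v w :
  sprod 1%:M w (cross u v) = - sprod 1%:M (cross u w) v.
Proof.
have [c0 c1 c2] := crossE u v; have [d0 d1 d2] := crossE u w.
by rewrite !dot3E c0 c1 c2 d0 d1 d2; ring.
Qed.

Lemma cross_cross u v :
  cross u (cross u v) = sprod 1%:M u v *: u - sprod 1%:M u u *: v.
Proof.
have [c0 c1 c2] := crossE u v; have [d0 d1 d2] := crossE u (cross u v).
apply/rowP => k; rewrite 2![in RHS]mxE [X in _ = _ + X]mxE [X in _ = _ - X]mxE !dot3E.
by case: (ord3P k) => ->; rewrite ?d0 ?d1 ?d2 ?c0 ?c1 ?c2; ring.
Qed.

(* The complex structure of the sphere read through stereo is w |-> - n x w. *)
Lemma stereo_complex_structure n w w' :
  sprod 1%:M n n = 1 -> sprod 1%:M w n = 0 -> sprod 1%:M w' n = 0 ->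
  n 0 2 != 1 ->
  w' 0 0 * (1 - n 0 2) + n 0 0 * w' 0 2 =
    - (w 0 1 * (1 - n 0 2) + n 0 1 * w 0 2) ->
  w' 0 1 * (1 - n 0 2) + n 0 1 * w' 0 2 =
    w 0 0 * (1 - n 0 2) + n 0 0 * w 0 2 ->
  w' = - cross n w.
Proof.
move=> nn wn w'n n2 E0 E1; have [c0 c1 c2] := crossE n w.
(* The difference y is tangent to the sphere and lies in the kernel of the differential of stereo,
   hence vanishes. *)
apply/eqP; rewrite -subr_eq0 opprK; set y := w' + _.
have yE k : y 0 k = w' 0 k + cross n w 0 k by rewrite mxE.
have yn : sprod 1%:M y n = 0 by rewrite sprodDl w'n dot_cross addr0.
move: nn wn yn; rewrite !dot3E => nn wn yn.
have b0 : 1 - n 0 2 != 0 by rewrite subr_eq0 eq_sym.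
have F0 : y 0 0 * (1 - n 0 2) + n 0 0 * y 0 2 = 0.
  transitivity (w' 0 0 * (1 - n 0 2) + n 0 0 * w' 0 2
      + (w 0 1 * (1 - n 0 2) + n 0 1 * w 0 2)
      + w 0 1 * (n 0 0 * n 0 0 + n 0 1 * n 0 1 + n 0 2 * n 0 2 - 1)
      - n 0 1 * (w 0 0 * n 0 0 + w 0 1 * n 0 1 + w 0 2 * n 0 2)).
    by rewrite !yE c0 c2; ring.
  by rewrite E0 nn wn; ring.
have F1 : y 0 1 * (1 - n 0 2) + n 0 1 * y 0 2 = 0.
  transitivity (w' 0 1 * (1 - n 0 2) + n 0 1 * w' 0 2
      - (w 0 0 * (1 - n 0 2) + n 0 0 * w 0 2)
      - w 0 0 * (n 0 0 * n 0 0 + n 0 1 * n 0 1 + n 0 2 * n 0 2 - 1)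
      + n 0 0 * (w 0 0 * n 0 0 + w 0 1 * n 0 1 + w 0 2 * n 0 2)).
    by rewrite !yE c1 c2; ring.
  by rewrite E1 nn wn; ring.
have y2 : y 0 2 = 0.
  apply: (mulIf b0); rewrite mul0r.
  transitivity (n 0 0 * (y 0 0 * (1 - n 0 2) + n 0 0 * y 0 2)
    + n 0 1 * (y 0 1 * (1 - n 0 2) + n 0 1 * y 0 2)
    - (1 - n 0 2) * (y 0 0 * n 0 0 + y 0 1 * n 0 1 + y 0 2 * n 0 2)
    - y 0 2 * (n 0 0 * n 0 0 + n 0 1 * n 0 1 + n 0 2 * n 0 2 - 1)); first by ring.
  by rewrite F0 F1 yn nn; ring.
have y0 : y 0 0 = 0.
  by apply: (mulIf b0); rewrite mul0r -F0 y2; ring.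
have y1 : y 0 1 = 0.
  by apply: (mulIf b0); rewrite mul0r -F1 y2; ring.
by apply/eqP/rowP => k; rewrite [RHS]mxE; case: (ord3P k) => ->.
Qed.

End Cross.

Section StereoDerivative.
Local Open Scope complex_scope.
Variables (R : realType) (S : surface R) (c : chart R S) (p : S).
Hypotheses (ca : atlas c) (cp : cdom c p).

Lemma pd_quotient i (f g : S -> R) : chart_smooth c f -> chart_smooth c g ->
  g p != 0 -> pd c i (fun q => f q / g q) p =
    (pd c i f p * g p - f p * pd c i g p) / g p ^+ 2.
Proof.
move=> sf sg g0; have K := cmapK ca cp.
have df := chart_smooth_diff sf cp; have dg := chart_smooth_diff sg cp.
rewrite pdM//; last exact: chart_diffV.
by rewrite pdV//; field.
Qed.

Variable M : S -> 'rV[R]_3.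
Hypothesis sM : smoothv M.

Let sMc k : chart_smooth c (fun q => M q 0 k) := sM k ca.
Let sc (a : R) : chart_smooth c (fun=> a) := chart_smooth_cst a.

Lemma pdC_stereo i : M p 0 2 != 1 ->
  pdC c i (@fin R \o (fun q => stereo (M q))) p =
  ((vd c i M p 0 0 * (1 - M p 0 2) + M p 0 0 * vd c i M p 0 2)
     / (1 - M p 0 2) ^+ 2) +i*
  ((vd c i M p 0 1 * (1 - M p 0 2) + M p 0 1 * vd c i M p 0 2)
     / (1 - M p 0 2) ^+ 2).
Proof.
move=> M2; have b0 : 1 - M p 0 2 != 0 by rewrite subr_eq0 eq_sym.
have s2 := chart_smoothB ca (sc 1) (sMc 2).
have d2 : pd c i (fun q => 1 - M q 0 2) p = - vd c i M p 0 2.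
  rewrite pdD ?pd_cst ?add0r.
  - by rewrite pdN ?vdE//; exact: chart_smooth_diff (sMc 2) cp.
  - exact: chart_diff_cst.
  - exact: chart_smooth_diff (chart_smoothN ca (sMc 2)) cp.
rewrite /pdC.
have -> : (fun q => complex.Re ((@fin R \o (fun q => stereo (M q))) q)) =
    (fun q => M q 0 0 / (1 - M q 0 2)).
  by apply/funext => q; rewrite /= fin_stereo.
have -> : (fun q => complex.Im ((@fin R \o (fun q => stereo (M q))) q)) =
    (fun q => M q 0 1 / (1 - M q 0 2)).
  by apply/funext => q; rewrite /= fin_stereo.
by rewrite !pd_quotient// d2 !mulrN !opprK !vdE.
Qed.

Lemma pdC_stereo_inv i : (forall q, sprod 1%:M (M q) (M q) = 1) ->
  M p 0 0 = 0 -> M p 0 1 = 0 -> M p 0 2 = 1 ->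
  pdC c i (@fin R \o @sphere_inv R \o (fun q => stereo (M q))) p =
  (vd c i M p 0 0 / 2) +i* (- (vd c i M p 0 1 / 2)).
Proof.
move=> MM M0 M1 M2.
have b0 : 1 + M p 0 2 != 0 by rewrite M2 (_ : 1 + 1 = 2)// pnatr_eq0.
have s2 := chart_smoothD ca (sc 1) (sMc 2).
rewrite /pdC.
have -> : (fun q => complex.Re ((@fin R \o @sphere_inv R \o (fun q => stereo (M q))) q)) =
    (fun q => M q 0 0 / (1 + M q 0 2)).
  by apply/funext => q; rewrite /= fin_sphere_inv_stereo.
have -> : (fun q => complex.Im ((@fin R \o @sphere_inv R \o (fun q => stereo (M q))) q)) =
    (fun q => - (M q 0 1 / (1 + M q 0 2))).
  by apply/funext => q; rewrite /= fin_sphere_inv_stereo.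
have d1 : chart_diff c (fun q => M q 0 1 / (1 + M q 0 2)) p.
  apply: chart_diffM; first exact: chart_smooth_diff (sMc 1) cp.
  by apply: chart_diffV => //; [exact: chart_smooth_diff s2 cp|exact: (cmapK ca)].
rewrite (pdN ca i d1 cp) !pd_quotient// M0 M1 M2 !mul0r !subr0 !vdE.
by congr (_ +i* _); [|congr (- _)]; field.
Qed.

End StereoDerivative.

(** * The Weierstrass form of a normalized pair *)

Section Weierstrass.
Local Open Scope complex_scope.
Variables (R : realType) (S : surface R).
Variables (Z N X : S -> 'rV[R]_3) (rho phi : S -> R).
Hypothesis h : normalized_pair Z N X rho phi.
Hypothesis hd : normalized_pair (dualZ Z X rho) (dualN N X phi)
  (dualX X rho phi) (fun p => (phi p)^-1) (fun p => (rho p)^-1).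
Hypothesis Zi : forall p, immersed_at Z p.
Hypothesis Zti : forall p, immersed_at (dualZ Z X rho) p.
Hypothesis min : minimal Z N.

Notation Nt := (dualN N X phi).

Lemma sphere_pole (x : 'rV[R]_3) : sprod 1%:M x x = 1 -> x 0 2 = 1 ->
  x 0 0 = 0 /\ x 0 1 = 0.
Proof.
rewrite dot3E => xx x2; have : x 0 0 ^+ 2 + x 0 1 ^+ 2 = 0 by rewrite x2 in xx; lra.
by move/eqP; rewrite paddr_eq0 ?sqr_ge0// !sqrf_eq0 => /andP[/eqP-> /eqP->].
Qed.

(** Where G+ is infinite the form is 0 by definition, and so is the coefficient, as dZ is orthogonal
    to (0, 0, 1) there. Where only G- is infinite, the coordinate 1 / G- is used. *)
Lemma gauss_form_coef c i p : atlas c -> cdom c p ->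
  gauss_form (fun q => stereo (Nt q)) (fun q => stereo (N q)) c i p =
  weierstrass_coef (N p) (vd c i Z p).
Proof.
move=> ca cp; rewrite /gauss_form.
have [n2|n2] := eqVneq (N p 0 2) 1.
  have [n0 n1] := sphere_pole (np_NN h p) n2.
  have -> : stereo (N p) = None by rewrite /stereo n2 eqxx.
  have w2 : vd c i Z p 0 2 = 0.
    by have := np_ZN h i ca cp; rewrite dot3E n0 n1 n2; lra.
  rewrite /weierstrass_coef n2 subrr w2 !mul0r addr0 oppr0.
  by case: (stereo (Nt p)).
have -> : stereo (N p) = Some (fin (stereo (N p))) by rewrite /stereo (negbTE n2).
have [m2|m2] := eqVneq (Nt p 0 2) 1.
  have [m0 m1] := sphere_pole (np_NN hd p) m2.
  have -> : stereo (Nt p) = None by rewrite /stereo m2 eqxx.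
  rewrite (pdC_stereo_inv ca cp (np_N hd) i (np_NN hd) m0 m1 m2).
  rewrite (vd_dualN h i ca cp).
  exact: (stereo_reflection_pole (np_NN h p) (np_ZN h i ca cp) (np_XX h p)
    (np_phi0 h p) m0 m1 m2).
have -> : stereo (Nt p) = Some (fin (stereo (Nt p))) by rewrite /stereo (negbTE m2).
rewrite (pdC_stereo ca cp (np_N hd) i m2) (vd_dualN h i ca cp).
exact: (stereo_reflection (np_NN h p) (np_ZN h i ca cp) (np_XN h p) (np_XX h p)
  (np_rho0 h p) (np_phi0 h p) n2 m2).
Qed.

Section Conformal.
Variable c : chart R S.
Hypothesis hc : conformal_chart Z N c.

Let ca : atlas c. Proof. by case: hc. Qed.

(** The Cauchy-Riemann equation of stereo o N, transported to the sphere; at the pole it is read off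
    from 1 / stereo. *)
Lemma conformal_gauss_map p : cdom c p -> vd c 1 N p = - cross (N p) (vd c 0 N p).
Proof.
move=> cp; have [_ _ mero] := hc; have [m1 m2] := mero p cp.
have dN i := pd_unit i ca cp (np_N h) (np_NN h).
have [n2|n2] := eqVneq (N p 0 2) 1.
  have [n0 n1] := sphere_pole (np_NN h p) n2.
  have /m2[_ hol] : (@stereo R \o N) p != Some 0 by rewrite /= /stereo n2 eqxx.
  have [_ _] := nbhs_singleton hol.
  rewrite !(pdC_stereo_inv ca cp (np_N h) _ (np_NN h) n0 n1 n2).
  move/eqP; rewrite eq_complex /= => /andP[/eqP E0 /eqP E1].
  have d2 i : vd c i N p 0 2 = 0 by have := dN i; rewrite dot3E n0 n1 n2; lra.
  have [c0 c1 c2] := crossE (N p) (vd c 0 N p).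
  apply/rowP => k; rewrite [RHS]mxE; case: (ord3P k) => ->;
    rewrite ?c0 ?c1 ?c2 ?d2 ?n0 ?n1 ?n2; lra.
have /m1[_ hol] : (@stereo R \o N) p != None by rewrite /= /stereo (negbTE n2).
have [_ _] := nbhs_singleton hol.
rewrite !(pdC_stereo ca cp (np_N h) _ n2).
move/eqP; rewrite eq_complex /= !(mul0r, mul1r, sub0r, add0r) -mulNr.
have b0 : (1 - N p 0 2) ^+ 2 != 0 by rewrite sqrf_eq0 subr_eq0 eq_sym.
have bi : (1 - N p 0 2) ^- 2 != 0 by rewrite invr_neq0.
move=> /andP[/eqP /(mulIf bi) E0 /eqP /(mulIf bi) E1].
exact: stereo_complex_structure (np_NN h p) (dN 0) (dN 1) n2 E0 E1.
Qed.

Lemma conformal_metric p : cdom c p ->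
  sprod 1%:M (vd c 0 Z p) (vd c 0 Z p) = sprod 1%:M (vd c 1 Z p) (vd c 1 Z p) /\
  sprod 1%:M (vd c 0 Z p) (vd c 1 Z p) = 0.
Proof.
move=> cp; have [_ /(_ p cp)/is_scalar_mxP[a aE] _] := hc.
by rewrite -!first_formE -/(formI c Z p) aE !mxE.
Qed.

(** Let y = d_1 Z - N x d_0 Z. By the relation between d_0 N and d_1 N, <y, d_0 N> = 0 is the
    symmetry of the second form, and <y, d_1 N> = 0 is the vanishing of its trace. *)
Lemma conformal_immersion p : cdom c p ->
  vd c 1 Z p = cross (N p) (vd c 0 Z p) /\
  vd c 0 Z p = - cross (N p) (vd c 1 Z p).
Proof.
move=> cp; have NN := np_NN h p.
have ZN i q : cdom c q -> sprod 1%:M (vd c i Z q) (N q) = 0.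
  by move=> cq; exact: (np_ZN h).
have dN i := pd_unit i ca cp (np_N h) (np_NN h).
have N1 := conformal_gauss_map cp.
have Ni := immersed_gauss_map h (Zti (p := p)) ca cp.
have sym := (shape_symmetric 1 0 ca cp (np_Z h) (np_N h) ZN).2.
have tr := minimal_trace ca cp (np_Z h) (np_N h) (Zi (p := p)) ZN min.
have D0 := formI_det_neq0 ca cp (Zi (p := p)).
have [E00 E01] := conformal_metric cp.
have Z0n := ZN 0 p cp; have Z1n := ZN 1 p cp.
have dN0 := dN 0; have dN1 := dN 1.
rewrite E01 E00 in tr D0.
have nN1 : cross (N p) (vd c 1 N p) = vd c 0 N p.
  have -> : cross (N p) (vd c 1 N p) = - cross (N p) (cross (N p) (vd c 0 N p)).
    have [c0 c1 c2] := crossE (N p) (cross (N p) (vd c 0 N p)).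
    have [e0 e1 e2] := crossE (N p) (vd c 1 N p).
    apply/rowP => k; rewrite [RHS]mxE.
    by case: (ord3P k) => ->; rewrite ?c0 ?c1 ?c2 ?e0 ?e1 ?e2 N1 !mxE; ring.
  by rewrite cross_cross NN dotnC dN0 scale0r sub0r scale1r opprK.
have tr0 : sprod 1%:M (vd c 0 N p) (vd c 0 Z p)
    + sprod 1%:M (vd c 1 N p) (vd c 1 Z p) = 0.
  move/eqP: tr; rewrite mulr0 mul0r subr0 -mulrDr mulf_eq0 => /orP[/eqP e0|/eqP//].
  by move: D0; rewrite e0 mul0r expr0n subrr eqxx.
have Z1 : vd c 1 Z p = cross (N p) (vd c 0 Z p).
  apply/eqP; rewrite -subr_eq0; apply/eqP.
  apply: (euclidean_frame Ni NN dN); first by rewrite sprodBl Z1n dot_cross subr0.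
  move=> i; rewrite -/(vd c i N p) sprodBl !(dotnC _ (vd c i N p)) dot_crossC opprK.
  case: (ord2P i) => ->; last by rewrite nN1 addrC.
  by rewrite -sym N1 sprodNl addNr.
split=> //; rewrite Z1 cross_cross NN dotnC Z0n.
by rewrite scale0r sub0r scale1r opprK.
Qed.

(** The tangential part of the Laplacian of [Z] vanishes by differentiating the conformality
    relations, and the normal part is the trace of the second form. *)
Lemma conformal_harmonic p : cdom c p ->
  vd c 1 (vd c 1 Z) p = - vd c 0 (vd c 0 Z) p.
Proof.
move=> cp; have NN := np_NN h p.
have ZN i q : cdom c q -> sprod 1%:M (vd c i Z q) (N q) = 0.
  by move=> cq; exact: (np_ZN h).
have sZ : chart_smoothv c Z by move=> k; apply: (np_Z h).
have sd i := chart_smoothv_vd ca i sZ.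
have E i : sprod 1%:M (vd c i (vd c 0 Z) p) (vd c 0 Z p) =
    sprod 1%:M (vd c i (vd c 1 Z) p) (vd c 1 Z p).
  have := pd_sprod ca 1%:M i (sd 0) (sd 0) cp.
  rewrite (pd_ext ca i cp (fun q cq => (conformal_metric cq).1)).
  rewrite (pd_sprod ca 1%:M i (sd 1) (sd 1) cp).
  rewrite (dotnC (vd c 0 Z p)) (dotnC (vd c 1 Z p)); lra.
have F i : sprod 1%:M (vd c i (vd c 0 Z) p) (vd c 1 Z p) =
    - sprod 1%:M (vd c i (vd c 1 Z) p) (vd c 0 Z p).
  have := pd_sprod ca 1%:M i (sd 0) (sd 1) cp.
  rewrite (pd_ext ca i cp (fun q cq => (conformal_metric cq).2)) pd_cst.
  rewrite (dotnC (vd c 0 Z p)); lra.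
have C := vd_vdC ca 0 1 sZ cp.
have G i := (shape_symmetric i i ca cp (np_Z h) (np_N h) ZN).1.
have tr := minimal_trace ca cp (np_Z h) (np_N h) (Zi (p := p)) ZN min.
have D0 := formI_det_neq0 ca cp (Zi (p := p)).
have [E00 E01] := conformal_metric cp.
rewrite E01 E00 in tr D0.
apply/eqP; rewrite -subr_eq0 opprK; apply/eqP.
apply: (euclidean_frame (Zi ca cp) NN (fun i => ZN i p cp)).
  rewrite sprodDl (G 0) (G 1); move/eqP: tr; rewrite mulr0 mul0r subr0 -mulrDr mulf_eq0.
  case/orP => [/eqP e0|/eqP].
    by move: D0; rewrite e0 mul0r expr0n subrr eqxx.
  by move=> tr; apply/eqP; rewrite -opprD oppr_eq0 addrC tr.
move=> i; rewrite -/(vd c i Z p) sprodDl; case: (ord2P i) => ->.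
  by rewrite E -{1}[sprod _ _ _]opprK -F C addNr.
by rewrite F -E C subrr.
Qed.

(** In a conformal chart the coefficient becomes the classical f_1 - i f_2, where f = d_0 Z - i d_1
    Z. Its Cauchy-Riemann equations are the harmonicity of [Z] and the symmetry of its second
    derivatives. *)
Lemma weierstrass_holomorphic p : cdom c p ->
  let om := gauss_form (fun q => stereo (Nt q)) (fun q => stereo (N q)) in
  om c 1 p = 'i * om c 0 p /\ holomorphic_at c (om c 0) p.
Proof.
move=> cp om.
have om0 q : cdom c q -> om c 0 q =
    (vd c 0 Z q 0 0 - vd c 1 Z q 0 1) +i* (- (vd c 0 Z q 0 1 + vd c 1 Z q 0 0)).
  move=> cq; rewrite /om gauss_form_coef// /weierstrass_coef.
  have [-> _] := conformal_immersion cq.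
  have [c0 c1 c2] := crossE (N q) (vd c 0 Z q).
  by rewrite c0 c1; apply/eqP; rewrite eq_complex /=; apply/andP; split; apply/eqP; ring.
have om1 q : cdom c q -> om c 1 q =
    (vd c 1 Z q 0 0 + vd c 0 Z q 0 1) +i* (vd c 0 Z q 0 0 - vd c 1 Z q 0 1).
  move=> cq; rewrite /om gauss_form_coef// /weierstrass_coef.
  have [_ ->] := conformal_immersion cq.
  have [c0 c1 c2] := crossE (N q) (vd c 1 Z q).
  rewrite [(- cross _ _) 0 0]mxE [(- cross _ _) 0 1]mxE.
  by rewrite c0 c1; apply/eqP; rewrite eq_complex /=; apply/andP; split; apply/eqP; ring.
split.
  rewrite om0// om1//; apply/eqP; rewrite eq_complex /=.
  by apply/andP; split; apply/eqP; ring.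
have sZ : chart_smoothv c Z by move=> k; apply: (np_Z h).
have sd i := chart_smoothv_vd ca i sZ.
have sRe := chart_smoothB ca (sd 0 0) (sd 1 1).
have sIm := chart_smoothN ca (chart_smoothD ca (sd 0 1) (sd 1 0)).
have sRe' : chart_smooth c (fun q => complex.Re (om c 0 q)).
  by apply: (eq_chart_smooth ca _ sRe) => q cq; rewrite om0.
have sIm' : chart_smooth c (fun q => complex.Im (om c 0 q)).
  by apply: (eq_chart_smooth ca _ sIm) => q cq; rewrite om0.
have : \forall q \near p, cdom c q.
  by apply: open_nbhs_nbhs; split => //; exact: cdom_open ca.
apply: filterS => q cq; split.
- exact: chart_smooth_diff sRe' cq.
- exact: chart_smooth_diff sIm' cq.
have dRe i : pd c i (fun q => complex.Re (om c 0 q)) q =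
    vd c i (vd c 0 Z) q 0 0 - vd c i (vd c 1 Z) q 0 1.
  rewrite (pd_ext ca i (g := fun q => vd c 0 Z q 0 0 - vd c 1 Z q 0 1) cq); last first.
    by move=> r cr; rewrite om0.
  rewrite (pdD i (chart_smooth_diff (sd 0 0) cq)
    (chart_smooth_diff (chart_smoothN ca (sd 1 1)) cq)).
  by rewrite (pdN ca i (chart_smooth_diff (sd 1 1) cq) cq) !vdE.
have dIm i : pd c i (fun q => complex.Im (om c 0 q)) q =
    - (vd c i (vd c 0 Z) q 0 1 + vd c i (vd c 1 Z) q 0 0).
  rewrite (pd_ext ca i (g := fun q => - (vd c 0 Z q 0 1 + vd c 1 Z q 0 0)) cq); last first.
    by move=> r cr; rewrite om0.
  rewrite (pdN ca i (chart_smooth_diff (chart_smoothD ca (sd 0 1) (sd 1 0)) cq) cq).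
  rewrite (pdD i (chart_smooth_diff (sd 0 1) cq) (chart_smooth_diff (sd 1 0) cq)).
  by rewrite !vdE.
rewrite /pdC !dRe !dIm.
have := conformal_harmonic cq; have := vd_vdC ca 1 0 sZ cq.
move=> -> ->; apply/eqP; rewrite eq_complex /= ![(- vd _ _ _ _) 0 _]mxE.
by apply/andP; split; apply/eqP; ring.
Qed.

End Conformal.

Lemma weierstrass_normalized_pair : weierstrass_data Z N
  (gauss_form (fun q => stereo (Nt q)) (fun q => stereo (N q)))
  (fun q => stereo (N q)).
Proof.
split=> // [c p hc cp|c p a ca cp aE i k]; first exact: weierstrass_holomorphic.
have n2 : N p 0 2 != 1.
  by apply/eqP => n2; move: aE; rewrite /stereo n2 eqxx.
rewrite gauss_form_coef// jac_row.
rewrite (weierstrass_representation (np_NN h p) (np_ZN h i ca cp) n2).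
by rewrite aE.
Qed.

End Weierstrass.

(** Identifies - grad rho / rho^2 in the formula for X^- as the gradient of 1 / rho, which is the
    [phi] of the exchanged pair. *)
Lemma grad_inv (R : realType) (S : surface R) (Z : S -> 'rV[R]_3) (f : S -> R) p :
  smooth f -> f p != 0 ->
  grad Z (fun q => (f q)^-1) p = - (f p ^+ 2)^-1 *: grad Z f p.
Proof.
move=> sf f0; have [ca cp] := chart_atP p; rewrite /grad.
set c := chart_at p in ca cp *.
have -> : dform c (fun q => (f q)^-1) p = - (f p ^+ 2)^-1 *: dform c f p.
  by apply/rowP => i; rewrite !mxE (pd_inv i ca cp sf f0); field.
by rewrite -!scalemxAl.
Qed.

Theorem theorem3p3 (R : realType) (S : surface R)
    (Z N Zt Nt : S -> 'rV[R]_3) (rho phi : S -> R)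
    (hpair : minimal_normalized_ribaucour_pair Z N Zt Nt)
    (hdata : ribaucour_data Z N Zt Nt rho phi) :
  let Xp := fun p => grad Z phi p + rho p *: N p in
  let Xm := fun p => - ((rho p ^+ 2)^-1 *: grad Zt rho p) + (phi p)^-1 *: Nt p in
  let Gp := fun p => stereo (N p) in
  let Gm := fun p => stereo (Nt p) in
  (exists X Nu : S -> 'rV[R]_(1 + 3),
    [/\ flat_front X Nu,
        associated_frontal 1 X Nu = Xp /\
          front3 Xp (lightlike_normal 1 X Nu),
        associated_frontal (- 1) X Nu = Xm /\
          front3 Xm (lightlike_normal (- 1) X Nu),
        hyperbolic_gauss_map 1 X Nu = Gp &
        hyperbolic_gauss_map (- 1) X Nu = Gm]) /\
  (let omega_m := gauss_form Gp Gm in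
   let omega_p := gauss_form Gm Gp in
   weierstrass_data Z N omega_p Gp /\ weierstrass_data Zt Nt omega_m Gm).
Proof.
move=> Xp Xm Gp Gm.
have [X [h ZtE NtE]] := normalized_pairP hpair hdata.
have {ZtE}ZtE : Zt = dualZ Z X rho by apply/funext.
have {NtE}NtE : Nt = dualN N X phi by apply/funext.
subst Zt Nt.
have [_ [_ [_ Zi] Zmin _] [[_ _ _ Zt_N] [_ Zti] Ztmin _] _] := hpair.
have hd : normalized_pair (dualZ Z X rho) (dualN N X phi) (dualX X rho phi)
    (fun p => (phi p)^-1) (fun p => (rho p)^-1).
  apply: (normalized_pair_dual h) => c p i ca cp.
  by apply/jac_tangent: i; exact: Zt_N.
have r0 := np_rho0 h; have f0 := np_phi0 h.
have XpE : Xp = X.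
  by apply/funext => p; rewrite /Xp (grad_normalized_pair (Zi p) h) subrK.
have XmE : Xm = dualX X rho phi.
  apply/funext => p; have := grad_normalized_pair (Zti p) hd.
  by rewrite (grad_inv _ (np_rho h) (r0 p)) scaleNr /Xm => ->; rewrite subrK.
have ddZ : dualZ (dualZ Z X rho) (dualX X rho phi) (fun p => (phi p)^-1) = Z.
  by apply/funext => p; have [] := dual_dual h p.
have ddN : dualN (dualN N X phi) (dualX X rho phi) (fun p => (rho p)^-1) = N.
  by apply/funext => p; have [] := dual_dual h p.
have ddX : dualX (dualX X rho phi) (fun p => (phi p)^-1) (fun p => (rho p)^-1) = X.
  apply/funext => p; apply/rowP => k; rewrite !mxE.
  by field; rewrite r0 f0.
(* The exchange applied twice gives back [h]; in this form it serves as the dual hypothesis when the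
   Weierstrass result is applied to the exchanged pair. *)
have hdd : normalized_pair
    (dualZ (dualZ Z X rho) (dualX X rho phi) (fun p => (phi p)^-1))
    (dualN (dualN N X phi) (dualX X rho phi) (fun p => (rho p)^-1))
    (dualX (dualX X rho phi) (fun p => (phi p)^-1) (fun p => (rho p)^-1))
    (fun p => ((rho p)^-1)^-1) (fun p => ((phi p)^-1)^-1).
  rewrite ddZ ddN ddX.
  have -> : (fun p => ((rho p)^-1)^-1) = rho by apply/funext => p; rewrite invrK.
  by have -> : (fun p => ((phi p)^-1)^-1) = phi by apply/funext => p; rewrite invrK.
split.
  exists (hfront N X rho phi 1 1), (hfront N X rho phi 1 (-1)).
  rewrite /hyperbolic_gauss_map XpE XmE (associated_frontal_p h) (associated_frontal_m h).
  rewrite (lightlike_normal_p h) (lightlike_normal_m h).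
  split=> //; first exact: (flat_hfront h Zi Zmin).
  - by split=> //; exact: (front_normalized_pair h Zi).
  - by split=> //; exact: (front_normalized_pair hd Zti).
split; first exact: (weierstrass_normalized_pair h hd Zi Zti Zmin).
(* The open premise says that the surface obtained by exchanging twice is immersed; that surface is
   [Z]. *)
have := weierstrass_normalized_pair hd hdd Zti _ Ztmin.
by rewrite ddZ ddN; exact.
Qed.
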